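(* Fix $n$ and let $1\le i_1,i_2,i_3\le n-2$, $i_5=i_1+i_2\le n-1$, $i_6=i_2+i_3\le n-1$, $i_4=i_1+i_2+i_3\le n$. Let $R=\mathbb{Q}[\mathcal X_{i_1,1},\mathcal X_{i_2,2},\mathcal X_{i_3,3},\mathcal X_{i_4,4}]$ and $$\omega=F_{i_4}(\mathcal X_{i_4,4})-F_{i_1}(\mathcal X_{i_1,1})-F_{i_2}(\mathcal X_{i_2,2})-F_{i_3}(\mathcal X_{i_3,3}).$$ (1) There is an isomorphism in $\mathrm{HMF}^{gr}_{R,\omega}$ $$\mathcal M_{i_5,i_3}(\mathcal X_{i_5,5},\mathcal X_{i_3,3};\mathcal X_{i_4,4})\boxtimes\mathcal M_{i_1,i_2}(\mathcal X_{i_1,1},\mathcal X_{i_2,2};\mathcal X_{i_5,5})\simeq\mathcal M_{i_1,i_6}(\mathcal X_{i_1,1},\mathcal X_{i_6,6};\mathcal X_{i_4,4})\boxtimes\mathcal M_{i_2,i_3}(\mathcal X_{i_2,2},\mathcal X_{i_3,3};\mathcal X_{i_6,6}).$$ (2) There is an isomorphism in $\mathrm{HMF}^{gr}_{R,-\omega}$ $$\mathcal S_{i_5,i_3}(\mathcal X_{i_5,5},\mathcal X_{i_3,3};\mathcal X_{i_4,4})\boxtimes\mathcal S_{i_1,i_2}(\mathcal X_{i_1,1},\mathcal X_{i_2,2};\mathcal X_{i_5,5})\simeq\mathcal S_{i_1,i_6}(\mathcal X_{i_1,1},\mathcal X_{i_6,6};\mathcal X_{i_4,4})\boxtimes\mathcal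 S_{i_2,i_3}(\mathcal X_{i_2,2},\mathcal X_{i_3,3};\mathcal X_{i_6,6}).$$
   Context: MATRIX FACTORIZATIONS. For a graded module $M$, $M\{m\}$ is $M$ with grading shifted up by $m$ (degree $i+m$ part of $M\{m\}$ is $M^i$). For a $\mathbb{Z}$-graded polynomial ring $R$ over $\mathbb{Q}$ and homogeneous $\omega\in R$, a matrix factorization with potential $\omega$ is $(M_0,M_1,d_0,d_1)$ with $M_0,M_1$ free graded $R$-modules (infinite rank allowed), $R$-linear $d_0:M_0\to M_1$, $d_1:M_1\to M_0$, $d_1d_0=\omega$, $d_0d_1=\omega$. Morphisms are pairs of grading-preserving $R$-linear maps commuting with differentials; $\mathrm{HMF}^{gr}_{R,\omega}$ is the category with morphisms modulo null-homotopic ones ($f_0=h_1d_{M_0}+d_{N_1}h_0$, $f_1=h_0d_{M_1}+d_{N_0}h_1$). Shift $\{m\}$ acts on both modules. Tensor product: $$\overline M\boxtimes\overline N=\left(\begin{matrix}M_0\otimes N_0\\ \oplus\\ M_1\otimes N_1\end{matrix},\ \begin{matrix}M_1\otimes N_0\\ \oplus\\ M_0\otimes N_1\end{matrix},\ \begin{pmatrix}d_{M_0}&-d_{N_1}\\ d_{N_0}&d_{M_1}\end{pmatrix},\ \begin{pmatrix}d_{M_1}&d_{N_1}\\ -d_{N_0}&d_{M_0}\end{pmatrix}\right),$$ where for factorizations over polynomial rings in named variables the tensor product of modules is over the polynomial ring in the common variables; potentials add. $K(a;b)_A=(A,A\{\tfrac12(\deg b-\deg a)\},a,b)$ for homogeneous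 $a,b\in A$. A factorization over a larger ring whose potential lies in a polynomial subring $R$ is regarded as a factorization over $R$ (of possibly infinite rank); thus internal variables (those of $\mathcal X_{i_5,5}$, $\mathcal X_{i_6,6}$) are not part of the base ring. DIAGRAM FACTORIZATIONS. $F_i$ is the polynomial with $F_i(e_1,\dots,e_i)=t_1^{n+1}+\cdots+t_i^{n+1}$, $e_j$ the elementary symmetric polynomials of $t_1,\dots,t_i$. $\mathcal X_{i,k}=(x_{1,k},\dots,x_{i,k})$ is a sequence of variables with $\deg x_{j,k}=2j$. All sequences below are of this kind. For $1\le p,q\le n-1$, $r=p+q\le n$, and $\mathbf x,\mathbf y,\mathbf z$ of lengths $p,q,r$, let $e_j=e_j(\mathbf x,\mathbf y)$ be the degree $2j$ term of $(1+x_1+\dots+x_p)(1+y_1+\dots+y_q)$, $1\le j\le r$. Merging trivalent vertex (edges colored $p,q$ merge into an edge colored $r$): $$\mathcal M_{p,q}(\mathbf x,\mathbf y;\mathbf z)=\boxtimes_{j=1}^rK\Big(\tfrac{F_r(e_1,\dots,e_{j-1},z_j,z_{j+1},\dots,z_r)-F_r(e_1,\dots,e_{j-1},e_j,z_{j+1},\dots,z_r)}{z_j-e_j};\,z_j-e_j\Big)_{\mathbb{Q}[\mathbf x,\mathbf y,\mathbf z]},$$ of potential $F_r(\mathbf z)-F_p(\mathbf x)-F_q(\mathbf y)$. Splitting trivalent vertex (edge colored $r$ splits into edges colored $p,q$): $$\mathcal S_{p,q}(\mathbf x,\mathbf y;\mathbf z)=\boxtimes_{j=1}^rK\Big(\tfrac{F_r(z_1,\dots,z_{j-1},e_j,e_{j+1},\dots,e_r)-F_r(z_1,\dots,z_{j-1},z_j,e_{j+1},\dots,e_r)}{e_j-z_j};\,e_j-z_j\Big)_{\mathbb{Q}[\mathbf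 x,\mathbf y,\mathbf z]}\{-pq\},$$ of potential $F_p(\mathbf x)+F_q(\mathbf y)-F_r(\mathbf z)$. The tensor products in the claim are the matrix factorizations of the two planar trees with three edges colored $i_1,i_2,i_3$ merging into (resp. splitting from) one edge colored $i_4$. *)

(* Defs.v *)
From HB Require Import structures.
From mathcomp Require Import all_boot all_order all_algebra.
From mathcomp Require Import fingroup perm finmap mpoly mxtens.
From Stdlib Require Import ClassicalEpsilon.

Set Implicit Arguments.
Unset Strict Implicit.
Unset Printing Implicit Defensive.

Import Order.TTheory GRing.Theory Num.Theory.
Local Open Scope ring_scope.

(* A Z-graded polynomial ring over Q is {mpoly rat[N]} together with the      *)
(* degrees w : 'I_N -> nat of its variables.                                  *)
Section Weights.
Variables (N : nat) (w : 'I_N -> nat).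

Definition wt (m : 'X_{1..N}) : nat := (\sum_i m i * w i)%N.

Lemma wt0 : wt 0%MM = 0%N.
Proof. by rewrite /wt big1 // => i _; rewrite mnm0E mul0n. Qed.

Lemma wtD : {morph wt : m1 m2 / (m1 + m2)%MM >-> (m1 + m2)%N}.
Proof.
by move=> m1 m2; rewrite /wt -big_split; apply: eq_bigr => i _; rewrite mnmDE mulnDl.
Qed.

HB.instance Definition _ := isMeasure.Build N wt wt0 wtD.

Definition whomog (k : int) (p : {mpoly rat[N]}) : Prop :=
  {in msupp p, forall m, (wt m)%:Z = k}.

(* mmeasure is one more than the top degree; wdeg 0 = 0 *)
Definition wdeg (p : {mpoly rat[N]}) : nat := (mmeasure wt p).-1.

End Weights.

Section Renaming.
Variables (a b : nat) (s : 'I_a -> 'I_b).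

Definition rename (p : {mpoly rat[a]}) : {mpoly rat[b]} :=
  p \mPo [tuple 'X_(s i) | i < a].

HB.instance Definition _ := GRing.RMorphism.copy rename
  (comp_mpoly [tuple 'X_(s i) | i < a] : {mpoly rat[a]} -> {mpoly rat[b]}).

End Renaming.

Section Concatenation.
Variable T : Type.

Definition cat2 (a b : nat) (f : 'I_a -> T) (g : 'I_b -> T) (k : 'I_(a + b)) : T :=
  match split k with inl i => f i | inr j => g j end.

Definition cat3 (a b c : nat) (f : 'I_a -> T) (g : 'I_b -> T) (h : 'I_c -> T) :
  'I_(a + b + c) -> T := cat2 (cat2 f g) h.

End Concatenation.

(* The graded-module axioms are not part of the record: they follow from the  *)
(* homogeneous basis required by free_graded.                                 *)
Record gmod (N : nat) := GMod {
  gm_car :> lmodType {mpoly rat[N]};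
  gm_hom : int -> gm_car -> Prop
}.

(* M is graded-isomorphic to the direct sum of the R{d i}, i : I, where the   *)
(* degree k part of R{m} is the degree (k - m) part of R.                     *)
Definition free_graded (N : nat) (w : 'I_N -> nat) (M : gmod N) : Prop :=
  exists (I : choiceType) (d : I -> int) (b : I -> M),
    let comb (c : {fsfun I -> {mpoly rat[N]} with 0}) : M :=
      \sum_(i <- finsupp c) c i *: b i in
    bijective comb /\
    forall k c, gm_hom k (comb c) <-> forall i, whomog w (k - d i) (c i).

Record mfact (N : nat) := MFact {
  mf0 : gmod N;
  mf1 : gmod N;
  mfd0 : {linear mf0 -> mf1};
  mfd1 : {linear mf1 -> mf0}
}.

Definition is_mfact (N : nat) (w : 'I_N -> nat) (omega : {mpoly rat[N]})
    (M : mfact N) : Prop :=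
  [/\ free_graded w (mf0 M), free_graded w (mf1 M),
      exists k, whomog w k omega,
      forall v, mfd1 M (mfd0 M v) = omega *: v
    & forall v, mfd0 M (mfd1 M v) = omega *: v].

Record mf_hom (N : nat) (A B : mfact N) := MFHom {
  mfh0 : {linear mf0 A -> mf0 B};
  mfh1 : {linear mf1 A -> mf1 B};
  mfh0_gr : forall k v, gm_hom k v -> gm_hom k (mfh0 v);
  mfh1_gr : forall k v, gm_hom k v -> gm_hom k (mfh1 v);
  mfh_d0 : forall v, mfd0 B (mfh0 v) = mfh1 (mfd0 A v);
  mfh_d1 : forall v, mfd1 B (mfh1 v) = mfh0 (mfd1 A v)
}.

Section HomCategory.
Variable N : nat.

Program Definition mf_id (A : mfact N) : mf_hom A A :=
  @MFHom N A A idfun idfun _ _ _ _.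

Program Definition mf_comp (A B C : mfact N) (g : mf_hom B C) (f : mf_hom A B) :
    mf_hom A C :=
  @MFHom N A C (mfh0 g \o mfh0 f) (mfh1 g \o mfh1 f) _ _ _ _.
Next Obligation. by do 2! apply: mfh0_gr. Qed.
Next Obligation. by do 2! apply: mfh1_gr. Qed.
Next Obligation. by rewrite !mfh_d0. Qed.
Next Obligation. by rewrite !mfh_d1. Qed.

Definition mf_homotopic (A B : mfact N) (f g : mf_hom A B) : Prop :=
  exists (h0 : {linear mf0 A -> mf1 B}) (h1 : {linear mf1 A -> mf0 B}),
    (forall v, mfh0 f v - mfh0 g v = h1 (mfd0 A v) + mfd1 B (h0 v)) /\
    (forall v, mfh1 f v - mfh1 g v = h0 (mfd1 A v) + mfd0 B (h1 v)).

End HomCategory.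

Definition hmf_iso (N : nat) (w : 'I_N -> nat) (omega : {mpoly rat[N]})
    (A B : mfact N) : Prop :=
  [/\ is_mfact w omega A, is_mfact w omega B &
      exists (f : mf_hom A B) (g : mf_hom B A),
        mf_homotopic (mf_comp g f) (mf_id A) /\
        mf_homotopic (mf_comp f g) (mf_id B)].

Definition restr (R S : pzRingType) (phi : {rmorphism R -> S}) (V : lmodType S) :
  Type := V.

Section Restriction.
Variables (R S : pzRingType) (phi : {rmorphism R -> S}) (V : lmodType S).

HB.instance Definition _ := GRing.Zmodule.on (restr phi V).

Let rscale (r : R) (v : restr phi V) : restr phi V := phi r *: (v : V).

Fact rscaleA a b v : rscale a (rscale b v) = rscale (a * b) v.
Proof. by rewrite /rscale scalerA rmorphM. Qed.

Fact rscale1 : left_id 1 rscale.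
Proof. by move=> v; rewrite /rscale rmorph1 scale1r. Qed.

Fact rscaleDr : right_distributive rscale +%R.
Proof. by move=> a u v; rewrite /rscale scalerDr. Qed.

Fact rscaleDl v : {morph rscale^~ v : a b / a + b}.
Proof. by move=> a b; rewrite /rscale rmorphD scalerDl. Qed.

HB.instance Definition _ := GRing.Zmodule_isLmodule.Build R (restr phi V)
  rscaleA rscale1 rscaleDr rscaleDl.

End Restriction.

Section RestrictionMap.
Variables (R S : pzRingType) (phi : {rmorphism R -> S}) (U V : lmodType S).
Variable f : {linear U -> V}.

Definition restr_map (u : restr phi U) : restr phi V := f u.

Fact restr_map_linear : linear restr_map.
Proof. by move=> a u v; rewrite /restr_map; exact: (linearP f (phi a)). Qed.

HB.instance Definition _ :=
  GRing.isLinear.Build R (restr phi U) (restr phi V) _ restr_map restr_map_linear.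

End RestrictionMap.

Definition restr_gmod (a b : nat) (phi : {rmorphism {mpoly rat[a]} -> {mpoly rat[b]}})
    (M : gmod b) : gmod a :=
  @GMod a (restr phi M) (fun k v => @gm_hom b M k v).

Definition restr_mfact (a b : nat) (phi : {rmorphism {mpoly rat[a]} -> {mpoly rat[b]}})
    (M : mfact b) : mfact a :=
  @MFact a (restr_gmod phi (mf0 M)) (restr_gmod phi (mf1 M))
    (@restr_map _ _ phi _ _ (mfd0 M)) (@restr_map _ _ phi _ _ (mfd1 M)).

(* Factorizations of finite rank, in homogeneous bases: the modules are the   *)
(* direct sums of the A{fsh0 i} and of the A{fsh1 i}, and the differentials   *)
(* are matrices acting on column vectors.                                     *)
Record fmfact (N : nat) := FMFact {
  frk0 : nat;
  frk1 : nat;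
  fsh0 : 'I_frk0 -> int;
  fsh1 : 'I_frk1 -> int;
  fmx0 : 'M[{mpoly rat[N]}]_(frk1, frk0);
  fmx1 : 'M[{mpoly rat[N]}]_(frk0, frk1)
}.

Definition free_gmod (N : nat) (w : 'I_N -> nat) (k : nat) (sh : 'I_k -> int) :
    gmod N :=
  @GMod N 'cV[{mpoly rat[N]}]_k (fun d v => forall i, whomog w (d - sh i) (v i 0)).

Definition mfact_of (N : nat) (w : 'I_N -> nat) (M : fmfact N) : mfact N :=
  @MFact N (free_gmod w (@fsh0 N M)) (free_gmod w (@fsh1 N M))
    (mulmx (fmx0 M)) (mulmx (fmx1 M)).

Section Operations.
Variable N : nat.
Implicit Types M P : fmfact N.

Definition fshift (m : int) M : fmfact N :=
  @FMFact N _ _ (fun i => fsh0 (f := M) i + m) (fun i => fsh1 (f := M) i + m)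
    (fmx0 M) (fmx1 M).

Definition tens_sh (a b : nat) (s : 'I_a -> int) (t : 'I_b -> int) (k : 'I_(a * b)) :
  int := s (mxtens_unindex k).1 + t (mxtens_unindex k).2.

(* *t is the Kronecker product: the matrix of a tensor product of linear maps *)
Definition ftens M P : fmfact N :=
  @FMFact N _ _
    (cat2 (tens_sh (@fsh0 N M) (@fsh0 N P)) (tens_sh (@fsh1 N M) (@fsh1 N P)))
    (cat2 (tens_sh (@fsh1 N M) (@fsh0 N P)) (tens_sh (@fsh0 N M) (@fsh1 N P)))
    (block_mx (fmx0 M *t 1%:M) (- (1%:M *t fmx1 P))
              (1%:M *t fmx0 P) (fmx1 M *t 1%:M))
    (block_mx (fmx1 M *t 1%:M) (1%:M *t fmx1 P)
              (- (1%:M *t fmx0 P)) (fmx0 M *t 1%:M)).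

(* the ring itself in position 0, of potential 0: unit of ftens *)
Definition funit : fmfact N :=
  @FMFact N 1 0 (fun=> 0) (fun=> 0) 0 0.

Definition koszul (w : 'I_N -> nat) (a b : {mpoly rat[N]}) : fmfact N :=
  @FMFact N 1 1 (fun=> 0)
    (fun=> (((wdeg w b)%:Z - (wdeg w a)%:Z) %/ 2)%Z) a%:M b%:M.

End Operations.

Definition frename (a b : nat) (s : 'I_a -> 'I_b) (M : fmfact a) : fmfact b :=
  @FMFact b _ _ (@fsh0 a M) (@fsh1 a M)
    (map_mx (rename s) (fmx0 M)) (map_mx (rename s) (fmx1 M)).

(* Tensor product of factorizations over Q[S] and Q[T], for sets of named     *)
(* variables S = s('I_a) and T = t('I_b) with union all of 'I_c, over the     *)
(* polynomial ring Q[S :&: T] in the common variables: since Q[S] and Q[T]    *)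
(* have tensor product Q[S :|: T] over Q[S :&: T], it is the tensor product   *)
(* over Q[S :|: T] of the extensions of scalars.                              *)
Definition boxtimes (a b c : nat) (s : 'I_a -> 'I_c) (t : 'I_b -> 'I_c)
    (M : fmfact a) (P : fmfact b) : fmfact c :=
  ftens (frename s M) (frename t P).

(* x_(j+1) has degree 2(j+1): indices are counted from 0 *)
Definition wX (i : nat) (j : 'I_i) : nat := (2 * j.+1)%N.

Lemma psum_sym (n i : nat) :
  (\sum_(j < i) 'X_j ^+ n.+1 : {mpoly rat[i]}) \is symmetric.
Proof.
apply/issymP => s; rewrite rmorph_sum /=.
rewrite [RHS](reindex_inj (@perm_inj _ s)) /=.
by apply: eq_bigr => j _; rewrite rmorphXn /= msymX; congr ('X_[_] ^+ _);
   apply/mnmP => k; rewrite !mnmE -(inj_eq (@perm_inj _ s)) permKV.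
Qed.

(* the F with F(e_1, ..., e_i) = t_1^(n+1) + ... + t_i^(n+1) *)
Definition Fpol (n i : nat) : {mpoly rat[i]} := sval (sym_fundamental (psum_sym n i)).

(* exact quotient: the c with c * q = p, unique for q != 0 *)
Definition quo (N : nat) (p q : {mpoly rat[N]}) : {mpoly rat[N]} :=
  epsilon (inhabits 0) (fun c => c * q = p).

Definition mix (T : Type) (r k : nat) (u v : 'I_r -> T) (i : 'I_r) : T :=
  if (i < k)%N then u i else v i.

Section Vertex.
Variables n p q r : nat.

Notation A := {mpoly rat[p + q + r]}.

Definition vx (j : 'I_p) : A := 'X_(lshift r (lshift q j)).
Definition vy (j : 'I_q) : A := 'X_(lshift r (rshift p j)).
Definition vz (j : 'I_r) : A := 'X_(rshift (p + q) j).

Definition wV : 'I_(p + q + r) -> nat := cat3 (@wX p) (@wX q) (@wX r).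

Definition ve (j : 'I_r) : A :=
  pihomog (wt wV) (2 * j.+1)%N ((1 + \sum_i vx i) * (1 + \sum_i vy i)).

Definition Fr (u : 'I_r -> A) : A := Fpol n r \mPo [tuple u i | i < r].

Definition vrow (u v : 'I_r -> A) (j : 'I_r) : fmfact (p + q + r) :=
  koszul wV (quo (Fr (mix j u v) - Fr (mix j.+1 u v)) (v j - u j)) (v j - u j).

Definition merge_mf : fmfact (p + q + r) :=
  \big[@ftens _/funit _]_(j < r) vrow ve vz j.

Definition split_mf : fmfact (p + q + r) :=
  fshift (- (p * q)%:Z) (\big[@ftens _/funit _]_(j < r) vrow vz ve j).

End Vertex.

(* Main.v *)
Require Import Defs.
From HB Require Import structures.
From mathcomp Require Import all_boot all_order all_algebra.
From mathcomp Require Import finmap mpoly mxtens zify ring.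
From Stdlib Require Import ClassicalEpsilon FunctionalExtensionality.

(* Over the ring of the external variables, tensoring a factorization F with   *)
(* K(a; x - e), where e does not involve x, amounts, up to homotopy,           *)
(* to setting x := e: the quotient map F (x) K(a; x - e) -> F|_(x := e) has an *)
(* explicit homotopy inverse, written with the "divided difference" theta of   *)
(* the projection p |-> p|_(x := e).  The rows of the vertex below the inner   *)
(* edge have second entry +-(x_j - e_j), so eliminating the inner variables    *)
(* one by one turns either tree into the Koszul factorization with second      *)
(* entries +-(z_j - E_j), E_j the degree j part of the product of the three    *)
(* total classes 1 + sum x; this is the same factorization for both trees.     *)
(* The gradings match because the first entries are nonzero, which, like the   *)
(* additivity of F on products of generating functions, follows from Newton's  *)
(* identities.                                                                 *)

Set Implicit Arguments.
Unset Strict Implicit.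
Unset Printing Implicit Defensive.

(* mpoly shadows mf0 *)
Import Defs.
Import Order.TTheory GRing.Theory Num.Theory.
Local Open Scope ring_scope.

(** * Substitutions and weighted homogeneity *)

(** A vertex is a Koszul factorization whose second entries express, up to sign, that the class z_j
    of its thick edge is the degree j part e_j of the product of the total classes of its thin
    edges. In a tree, the vertex whose thick edge is internal has rows (a_j; +-(x_j - e_j)) with x_j
    internal and e_j external. Such a row b imposes the equation b = 0: over the external ring,
    tensoring F with K(a; b) is homotopy equivalent to reducing F modulo b, provided b is nonzero,
    the quotient by b lifts to a subring and the total potential comes from that subring
    ([cone_heq]). Iterating this ([eliminate], [contract]) leaves the rows of the other vertex with
    the internal classes replaced by their external values ([reduced]). Their second entries are
    +-(z_j - E_j), where the generating polynomial of the E_j is the product of those of the three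
    thin edges; associativity of that product makes them equal for both trees. The first entries are
    then forced, being exact quotients by nonzero polynomials.

    The total potential is external because F is additive on products of total classes
    ([psum_genpM]): F_r is a power sum, and power sums are, up to sign, the coefficients of the
    logarithmic derivative of the generating polynomial ([newton]).

    The gradings agree because the shift that [koszul] reads off the degrees of its entries is the
    expected one ([vrow_shift]). This requires the first entries to be nonzero, which [vdiff_neq0]
    obtains from specializations at which two power sums differ.

    Finally, over the external ring the modules have infinite rank; they are free on the monomials
    in the internal variables ([free_graded_restr]). *)

Definition sub a b (u : 'I_a -> {mpoly rat[b]}) : {mpoly rat[a]} -> {mpoly rat[b]} :=
  comp_mpoly [tuple u i | i < a].

HB.instance Definition _ a b (u : 'I_a -> {mpoly rat[b]}) :=
  GRing.RMorphism.copy (sub u) (comp_mpoly [tuple u i | i < a]).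
HB.instance Definition _ a b (u : 'I_a -> {mpoly rat[b]}) :=
  GRing.Linear.copy (sub u) (comp_mpoly [tuple u i | i < a]).

Section Sub.
Variables (a b : nat).

Lemma subX (u : 'I_a -> {mpoly rat[b]}) i : sub u 'X_i = u i.
Proof. by rewrite /sub comp_mpolyXU -tnth_nth tnth_mktuple. Qed.

Lemma subC (u : 'I_a -> {mpoly rat[b]}) x : sub u x%:MP = x%:MP.
Proof. exact: comp_mpolyC. Qed.

Lemma subXm (u : 'I_a -> {mpoly rat[b]}) m :
  sub u 'X_[m] = \prod_(i < a) u i ^+ m i.
Proof. by rewrite /sub comp_mpolyX; apply: eq_bigr => i _; rewrite tnth_mktuple. Qed.

Lemma eq_sub (u v : 'I_a -> {mpoly rat[b]}) : u =1 v -> sub u =1 sub v.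
Proof. by move=> uv p; rewrite /sub (eq_mktuple _ uv). Qed.

Lemma renameE (s : 'I_a -> 'I_b) : rename s =1 sub (fun i => 'X_(s i)).
Proof. by []. Qed.

End Sub.

Section SubComp.
Variables (a b c : nat).

Lemma sub_sub (u : 'I_b -> {mpoly rat[c]}) (v : 'I_a -> {mpoly rat[b]}) p :
  sub u (sub v p) = sub (fun i => sub u (v i)) p.
Proof.
elim/mpolyind: p => [|x m p _ _ IH]; first by rewrite !rmorph0.
rewrite !(rmorphD (sub _)) /= IH !linearZ /= !subXm rmorph_prod; congr (_ *: _ + _).
by apply: eq_bigr => i _; rewrite rmorphXn.
Qed.

Lemma sub_rename (u : 'I_b -> {mpoly rat[c]}) (s : 'I_a -> 'I_b) p :
  sub u (rename s p) = sub (u \o s) p.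
Proof. by rewrite renameE sub_sub; apply: eq_sub => i; rewrite subX. Qed.

Lemma rename_sub (s : 'I_b -> 'I_c) (u : 'I_a -> {mpoly rat[b]}) p :
  rename s (sub u p) = sub (fun i => rename s (u i)) p.
Proof. by rewrite renameE sub_sub. Qed.

Lemma sub_id (u : 'I_a -> {mpoly rat[a]}) p : (forall i, u i = 'X_i) -> sub u p = p.
Proof. by move=> uX; rewrite (eq_sub uX) /sub comp_mpoly_id. Qed.

Lemma renameX (s : 'I_a -> 'I_b) i : rename s 'X_i = 'X_(s i).
Proof. by rewrite renameE subX. Qed.

(** Congruence modulo [d] is compatible with sums and products, so it passes from the variables to
    all polynomials. It makes the quotients in the rows exact and gives the division with remainder
    of [tow_decomp]. *)
Lemma sub_dvd (u v : 'I_a -> {mpoly rat[b]}) (d : {mpoly rat[b]}) :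
  (forall i, exists e, e * d = u i - v i) -> forall p, exists e, e * d = sub u p - sub v p.
Proof.
move=> duv p; elim/mpolyind: p => [|x m p _ _ [e ep]].
  by exists 0; rewrite !rmorph0 mul0r subr0.
have [e' e'm] : exists e, e * d = sub u 'X_[m] - sub v 'X_[m].
  rewrite !subXm; elim/big_ind2: _ => [|x1 x2 y1 y2 [e1 h1] [e2 h2]|i _].
  - by exists 0; rewrite mul0r subrr.
  - by exists (e1 * y1 + x2 * e2); rewrite mulrDl mulrAC h1 -mulrA h2; ring.
  - have [e1 h1] := duv i; elim: (m i) => [|k [e2 h2]].
      by exists 0; rewrite mul0r subrr.
    by exists (e1 * u i ^+ k + v i * e2); rewrite !exprS mulrDl mulrAC h1 -mulrA h2; ring.
exists (x *: e' + e); rewrite mulrDl -scalerAl e'm ep scalerBr.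
by rewrite !(rmorphD (sub _)) /= !(linearZ_LR (sub _)) /= opprD addrACA.
Qed.

End SubComp.

Section Homogeneous.
Variable N : nat.
Implicit Types (w : 'I_N -> nat) (p q : {mpoly rat[N]}).

(* The action of the scalar 2 of the grading torus: weighted homogeneity is   *)
(* being an eigenvector, which makes it visibly multiplicative.               *)
Definition scal w : {mpoly rat[N]} -> {mpoly rat[N]} :=
  sub (fun i => (2 ^+ w i : rat) *: 'X_i).

Lemma scalXm w m : scal w 'X_[m] = (2 ^+ wt w m : rat) *: 'X_[m].
Proof.
rewrite /scal subXm (mpolyXE_id rat m) /wt -prodrXr -scaler_prod.
by apply: eq_bigr => i _; rewrite exprZn -exprM mulnC.
Qed.

Lemma mcoeff_scal w p m : (scal w p)@_m = 2 ^+ wt w m * p@_m.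
Proof.
elim/mpolyind: p => [|x m' p _ _ IH]; first by rewrite /scal rmorph0 mcoeff0 mulr0.
rewrite /scal rmorphD /= linearZ /= -!/(scal w _) !mcoeffD mulrDr IH scalXm !mcoeffZ mcoeffX.
by case: eqP => [->|_]; rewrite ?mulr0 // mulr1 mulr1 mulrC.
Qed.

(** 2 is not a root of unity, so the eigenvalue of [scal] on a nonzero polynomial determines its
    weight. *)
Lemma exp2z_inj : injective (fun k : int => (2 : rat) ^ k).
Proof. by apply: ieexprIz => //. Qed.

Lemma whomogP w k p : whomog w k p <-> scal w p = ((2 : rat) ^ k) *: p.
Proof.
split=> [hp|hp m].
  apply/mpolyP => m; rewrite mcoeff_scal mcoeffZ.
  have [|/memN_msupp_eq0 ->] := boolP (m \in msupp p); last by rewrite !mulr0.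
  by move/hp <-.
rewrite mcoeff_msupp => pm; apply: exp2z_inj; apply: (mulIf pm) => /=.
by have := congr1 (mcoeff m) hp; rewrite mcoeff_scal mcoeffZ.
Qed.

Lemma whomogX w i : whomog w (w i)%:Z 'X_i.
Proof. by apply/whomogP; rewrite /scal subX. Qed.

Lemma whomog0 w k : whomog w k 0.
Proof. by move=> m; rewrite msupp0. Qed.

Lemma whomogC w c : whomog w 0 c%:MP.
Proof. by apply/whomogP; rewrite /scal subC scale1r. Qed.

Lemma whomog1 w : whomog w 0 1.
Proof. by rewrite -mpolyC1; apply: whomogC. Qed.

Lemma whomogD w k p q : whomog w k p -> whomog w k q -> whomog w k (p + q).
Proof. by rewrite !whomogP => hp hq; rewrite /scal rmorphD /= -!/(scal w _) hp hq scalerDr. Qed.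

Lemma whomogN w k p : whomog w k p -> whomog w k (- p).
Proof. by rewrite !whomogP => hp; rewrite /scal rmorphN /= -!/(scal w _) hp scalerN. Qed.

Lemma whomogB w k p q : whomog w k p -> whomog w k q -> whomog w k (p - q).
Proof. by move=> hp hq; apply: whomogD => //; apply: whomogN. Qed.

Lemma whomog_sum w k (I : Type) (r : seq I) (P : pred I) (F : I -> {mpoly rat[N]}) :
  (forall i, P i -> whomog w k (F i)) -> whomog w k (\sum_(i <- r | P i) F i).
Proof. by move=> hF; elim/big_ind: _ => //; [apply: whomog0 | move=> *; apply: whomogD]. Qed.

Lemma whomogM w k l p q : whomog w k p -> whomog w l q -> whomog w (k + l) (p * q).
Proof.
rewrite !whomogP => hp hq; rewrite /scal rmorphM /= -!/(scal w _) hp hq.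
by rewrite -scalerAl -scalerAr scalerA expfzDr.
Qed.

(** Eigenvectors can be divided in a domain. The degrees of the first entries of rows, and of
    [theta] below, are obtained in this way. *)
Lemma whomog_quo w k l p q :
  q != 0 -> whomog w l q -> whomog w (k + l) (p * q) -> whomog w k p.
Proof.
rewrite !whomogP => q0 hq; rewrite /scal rmorphM /= -!/(scal w _) hq => hpq.
have e2 : (2 : rat) ^ l != 0 by rewrite expfz_neq0.
apply: (mulIf q0); apply: (scalerI e2); rewrite scalerAr hpq.
by rewrite -scalerAl scalerA expfzDr // mulrC.
Qed.

(** [koszul] computes its shift from [wdeg], which sends 0 to 0; hence the nonvanishing lemmas for
    the entries of rows. *)
Lemma wdeg_whomog w (k : nat) p : p != 0 -> whomog w k%:Z p -> wdeg w p = k.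
Proof.
move=> p0 hp; rewrite /wdeg mmeasureE.
have -> : (\max_(m <- msupp p) (wt w m).+1 = \max_(m <- msupp p) k.+1)%N.
  by apply: eq_big_seq => m /hp [->].
move: p0; rewrite -msupp_eq0; case: (msupp p) => // m s _.
rewrite big_cons; elim: s => [|m' s IH]; first by rewrite big_nil maxn0.
by rewrite big_cons maxnA maxnn.
Qed.

End Homogeneous.

Lemma whomog_sub a b (w : 'I_a -> nat) (w' : 'I_b -> nat) (u : 'I_a -> {mpoly rat[b]}) k p :
  (forall i, whomog w' (w i)%:Z (u i)) -> whomog w k p -> whomog w' k (sub u p).
Proof.
move=> hu /whomogP hp; apply/whomogP; rewrite {1}/scal sub_sub.
have -> : sub (fun i => sub (fun j => (2 ^+ w' j : rat) *: 'X_j) (u i)) p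
        = sub (fun i => (2 ^+ w i : rat) *: u i) p.
  by apply: eq_sub => i; have /whomogP := hu i.
transitivity (sub u (scal w p)); last by rewrite hp linearZ.
by rewrite /scal sub_sub; apply: eq_sub => i; rewrite linearZ /= subX.
Qed.

Lemma whomog_rename a b (w : 'I_a -> nat) (w' : 'I_b -> nat) (s : 'I_a -> 'I_b) k p :
  (forall i, w' (s i) = w i) -> whomog w k p -> whomog w' k (rename s p).
Proof.
by move=> hs; apply: whomog_sub => i; rewrite -hs; apply: whomogX.
Qed.

(** * Logarithmic derivatives and Newton's identities *)

Section LogDerivative.
Variable B : comNzRingType.
Implicit Types (P Q D : {poly B}) (s : nat -> B).

(* The power series sum_k s_k T^k is the logarithmic derivative of P. *)
Definition logder P s :=
  forall m, P^`()`_m = \sum_(j < m.+1) P`_j * s (m - j)%N.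

(** Coefficient [m] of the product only sees the terms of [s] up to [m], so a truncation can stand
    for the power series and polynomial arithmetic applies. *)
Lemma logder_trunc P s M m :
  logder P s -> (m < M)%N -> P^`()`_m = (P * \poly_(i < M) s i)`_m.
Proof.
move=> hP mM; rewrite hP coefM; apply: eq_bigr => j _.
by rewrite coef_poly (leq_ltn_trans (leq_subr _ _) mM).
Qed.

Lemma logderM P Q s t :
  logder P s -> logder Q t -> logder (P * Q) (fun k => s k + t k).
Proof.
move=> hP hQ m; pose q u : {poly B} := \poly_(i < m.+1) u i.
transitivity ((P * Q * (q s + q t))`_m); last first.
  rewrite coefM; apply: eq_bigr => j _; rewrite coefD !coef_poly ltnS leq_subr //.
have -> : P * Q * (q s + q t) = (P * q s) * Q + P * (Q * q t) by ring.
rewrite derivM !coefD !coefM; congr (_ + _); apply: eq_bigr => j _; congr (_ * _).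
  exact: logder_trunc.
by apply: logder_trunc; rewrite // ltnS leq_subr.
Qed.

Lemma logder1 : logder 1 (fun=> 0).
Proof. by move=> m; rewrite derivC coef0 big1 // => j _; rewrite mulr0. Qed.

Lemma logder_lin t : logder (1 + t *: 'X) (fun k => - (- t) ^+ k.+1).
Proof.
move=> m; rewrite derivD derivC add0r derivZ derivX alg_polyC coefC.
rewrite big_ord_recl /= subn0 coefD coef1 coefZ coefX mulr0 addr0 mul1r.
case: m => [|m]; first by rewrite big_ord0 addr0 expr1 opprK.
rewrite big_ord_recl big1 => [|j _]; last first.
  by rewrite coefD coef1 coefZ coefX /= mulr0 addr0 mul0r.
by rewrite coefD coef1 coefZ coefX /= /bump /= subSS subn0 exprS; ring.
Qed.

Lemma logder_prod (I : Type) (r : seq I) (t : I -> B) :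
  logder (\prod_(i <- r) (1 + t i *: 'X)) (fun k => \sum_(i <- r) - (- t i) ^+ k.+1).
Proof.
elim: r => [|i r IH].
  by rewrite big_nil => m; rewrite logder1; apply: eq_bigr => j _; rewrite big_nil.
rewrite big_cons => m; rewrite (logderM (@logder_lin (t i)) IH).
by apply: eq_bigr => j _; rewrite big_cons.
Qed.

(** With constant term 1, coefficient [m] of the defining identity expresses [s m] through earlier
    terms. *)
Lemma logder_inj P s t : P`_0 = 1 -> logder P s -> logder P t -> s =1 t.
Proof.
move=> P0 hs ht; elim/ltn_ind => m IH.
have := hs m; rewrite ht !big_ord_recl /= !subn0 P0 !mul1r => e.
apply: (addIr (\sum_(i < m) P`_(bump 0 i) * t (m - bump 0 i)%N)); rewrite e.
congr (_ + _); apply: eq_bigr => j _; rewrite IH //.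
by rewrite /bump /= add1n ltn_subrL /= (leq_ltn_trans _ (ltn_ord j)).
Qed.

End LogDerivative.

Lemma logder_map (B C : comNzRingType) (f : {rmorphism B -> C}) (P : {poly B}) s :
  logder P s -> logder (map_poly f P) (f \o s).
Proof.
move=> hP m; rewrite deriv_map coef_map hP /= rmorph_sum; apply: eq_bigr => j _.
by rewrite coef_map rmorphM.
Qed.

(** * Generating polynomials of classes and power sums of their virtual roots *)

Section PowerSums.

Definition genp (B : comNzRingType) r (u : 'I_r -> B) : {poly B} :=
  1 + \sum_(j < r) u j *: 'X^(j.+1).

Lemma coef_genp (B : comNzRingType) r (u : 'I_r -> B) (j : 'I_r) : (genp u)`_j.+1 = u j.
Proof.
rewrite /genp coefD coef1 add0r coef_sum (bigD1 j) //= coefZ coefXn eqxx mulr1.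
rewrite big1 ?addr0 // => i ij; rewrite coefZ coefXn eqSS.
by rewrite (inj_eq val_inj) eq_sym (negbTE ij) mulr0.
Qed.

Lemma coef_genp0 (B : comNzRingType) r (u : 'I_r -> B) : (genp u)`_0 = 1.
Proof.
rewrite /genp coefD coef1 coef_sum big1 ?addr0 // => i _.
by rewrite coefZ coefXn mulr0.
Qed.

Lemma genp_inj (B : comNzRingType) r (u v : 'I_r -> B) : genp u = genp v -> u =1 v.
Proof. by move=> uv j; rewrite -coef_genp uv coef_genp. Qed.

Lemma eq_genp (B : comNzRingType) r (u v : 'I_r -> B) : u =1 v -> genp u = genp v.
Proof. by move=> uv; congr (1 + _); apply: eq_bigr => j _; rewrite uv. Qed.

Lemma map_genp (B C : comNzRingType) (f : {rmorphism B -> C}) r (u : 'I_r -> B) :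
  map_poly f (genp u) = genp (f \o u).
Proof.
rewrite /genp rmorphD rmorph1 rmorph_sum /=; congr (_ + _); apply: eq_bigr => j _.
by rewrite /= map_polyZ map_polyXn.
Qed.

(** Expand the product over subsets of the index set and group them by cardinality. *)
Lemma genp_mesym r :
  genp (fun j : 'I_r => mesym r rat j.+1) = \prod_(i < r) (1 + 'X_i *: 'X).
Proof.
under [RHS]eq_bigr do rewrite addrC.
rewrite bigA_distr.
rewrite (partition_big (fun J : {set 'I_r} => inord #|J| : 'I_r.+1) predT) //=.
have e (k : 'I_r.+1) : \sum_(J : {set 'I_r} | inord #|J| == k)
    \prod_(i < r) (if i \in J then 'X_i *: 'X else 1)
   = mesym r rat k *: ('X^k : {poly {mpoly rat[r]}}).
  rewrite /mesym scaler_suml; apply: eq_big => [J|J /eqP Jk].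
    rewrite -(inj_eq val_inj) /= inordK // ltnS -[X in (_ <= X)%N]card_ord.
    exact: max_card.
  rewrite -big_mkcond /= scaler_prod prodr_const; congr (_ *: 'X^_).
  rewrite -Jk inordK // ltnS -[X in (_ <= X)%N]card_ord; exact: max_card.
rewrite (eq_bigr _ (fun k _ => e k)) big_ord_recl /=.
by rewrite mesym0E expr0 scale1r.
Qed.

(** F_r with [u] in the place of the elementary symmetric polynomials: the power sum of exponent m+1
    of the virtual roots of [genp u]. *)
Definition psum b r (u : 'I_r -> {mpoly rat[b]}) m := sub u (Fpol m r).

Lemma Fpol_mesym m r :
  psum (fun j : 'I_r => mesym r rat j.+1) m = \sum_(j < r) 'X_j ^+ m.+1.
Proof. exact: (svalP (sym_fundamental (psum_sym m r))).1. Qed.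

(** [Fpol] is only known through its value at the elementary symmetric polynomials. These are
    algebraically independent, so the identity may be checked after substituting them, where the
    generating polynomial splits into linear factors. *)
Lemma logder_generic r :
  logder (genp (fun j : 'I_r => 'X_j : {mpoly rat[r]}))
         (fun k => (-1) ^+ k * Fpol k r).
Proof.
move=> m; apply: msym_fundamental_un; pose S j := mesym r rat (nat_of_ord (j : 'I_r)).+1.
change (sub S (((genp (fun j : 'I_r => 'X_j : {mpoly rat[r]}))^`())`_m)
  = sub S (\sum_(j < m.+1) (genp (fun j : 'I_r => 'X_j))`_j * ((-1) ^+ (m - j) * Fpol (m - j) r))).
have gS : map_poly (sub S) (genp (fun j : 'I_r => 'X_j)) = \prod_(i < r) (1 + 'X_i *: 'X).
  by rewrite map_genp -genp_mesym; apply: eq_genp => j; rewrite /= subX.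
rewrite (rmorph_sum (sub S)) /= -coef_map -deriv_map gS logder_prod.
apply: eq_bigr => j _; rewrite !(rmorphM (sub S)) -coef_map gS; congr (_ * _).
rewrite (rmorphXn (sub S)) (rmorphN1 (sub S)) /=.
have -> : sub S (Fpol (m - j) r) = \sum_(i < r) 'X_i ^+ (m - j).+1 by exact: Fpol_mesym.
by rewrite mulr_sumr; apply: eq_bigr => i _; rewrite exprNn exprS mulN1r mulNr opprK.
Qed.

Lemma newton b r (u : 'I_r -> {mpoly rat[b]}) :
  logder (genp u) (fun k => (-1) ^+ k * psum u k).
Proof.
have := logder_map (sub u) (@logder_generic r).
rewrite map_genp (@eq_genp _ _ _ u); last by move=> j /=; rewrite subX.
by move=> h m; rewrite h; apply: eq_bigr => j _; rewrite /= rmorphM rmorphXn rmorphN1.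
Qed.

(** A logarithmic derivative turns products into sums, and it determines the power sums. *)
Lemma psum_genpM b p q r (u : 'I_p -> {mpoly rat[b]}) (v : 'I_q -> {mpoly rat[b]})
    (e : 'I_r -> {mpoly rat[b]}) m :
  genp e = genp u * genp v -> psum e m = psum u m + psum v m.
Proof.
move=> he; have := logderM (newton u) (newton v); rewrite -he => h.
have := logder_inj (coef_genp0 e) (newton e) h m; rewrite -mulrDr.
by apply: lreg_sign.
Qed.

Lemma genp_scal r (B : comNzRingType) (u v : 'I_r -> B) (c : B) :
  (forall j, v j = c ^+ j.+1 * u j) -> forall k, (genp v)`_k = c ^+ k * (genp u)`_k.
Proof.
move=> uv [|k]; first by rewrite !coef_genp0 mul1r.
have [kr|rk] := ltnP k r; first by rewrite !(coef_genp _ (Ordinal kr)) uv.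
by rewrite /genp !coefD !coef1 !coef_sum !big1 ?addr0 ?mulr0 // => i _;
  rewrite coefZ coefXn eqSS gtn_eqF ?mulr0 // (leq_trans _ rk).
Qed.

(* Substituting c^j u_j for u_j replaces T by cT in the generating function. *)
Lemma psum_scal b r (u v : 'I_r -> {mpoly rat[b]}) (c : {mpoly rat[b]}) m :
  (forall j, v j = c ^+ j.+1 * u j) -> psum v m = c ^+ m.+1 * psum u m.
Proof.
move=> uv; have h : logder (genp v) (fun k => c ^+ k.+1 * ((-1) ^+ k * psum u k)).
  move=> k; rewrite coef_deriv (genp_scal uv) -mulrnAr -coef_deriv newton mulr_sumr.
  apply: eq_bigr => j _; rewrite (genp_scal uv).
  have -> : c ^+ k.+1 = c ^+ j * c ^+ (k - j).+1.
    by rewrite -exprD addnS subnKC // -ltnS.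
  by ring.
have := logder_inj (coef_genp0 v) (newton v) h m; rewrite mulrCA.
by apply: lreg_sign.
Qed.

Lemma whomog_Fpol m r : whomog (@wX r) (2 * m.+1)%N (Fpol m r).
Proof.
apply/whomogP; rewrite -exprnP -mul_mpolyC.
have -> : Fpol m r = psum (fun i => 'X_i) m by rewrite /psum sub_id.
rewrite /scal /psum sub_sub (@eq_sub _ _ _ (fun i : 'I_r => (2 ^+ wX i)%:MP * 'X_i)).
  (* Since x_(j+1) has degree 2(j+1), the torus element 2 scales it by 4^(j+1): [psum_scal] applies
     with c = 4. *)
  rewrite exprM !rmorphXn /=; apply: (@psum_scal _ _ (fun i => 'X_i)) => j.
  by rewrite /wX exprM !rmorphXn.
by move=> i; rewrite subX mul_mpolyC.
Qed.

Lemma whomog_psum b r (w : 'I_b -> nat) (u : 'I_r -> {mpoly rat[b]}) m :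
  (forall j : 'I_r, whomog w (2 * j.+1)%N (u j)) -> whomog w (2 * m.+1)%N (psum u m).
Proof. by move=> hu; apply: (whomog_sub (w := @wX r)) => //; apply: whomog_Fpol. Qed.

End PowerSums.

Lemma natr_mpoly_eq0 b k : ((k%:R : {mpoly rat[b]}) == 0) = (k == 0%N).
Proof. by rewrite -mpolyC_nat mpolyC_eq0 pnatr_eq0. Qed.

Section PowerSumValues.
Variables (b r : nat).
Hypothesis r_gt0 : (0 < r)%N.

Lemma genp_delta0 (u : 'I_r -> {mpoly rat[b]}) :
  (forall j, u j = (j == 0%N :> nat)%:R) -> genp u = 1 + 1 *: 'X.
Proof.
move=> hu; rewrite /genp (bigD1 (Ordinal r_gt0)) //= hu /= expr1.
rewrite big1 ?addr0 // => i i0; rewrite hu.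
by move: i0; rewrite -(inj_eq val_inj) /= => /negbTE ->; rewrite scale0r.
Qed.

(** The generating polynomial is 1 + T, with the single virtual root 1. *)
Lemma psum_delta0 (u : 'I_r -> {mpoly rat[b]}) m :
  (forall j, u j = (j == 0%N :> nat)%:R) -> psum u m = 1.
Proof.
move=> /genp_delta0 hu; have := newton u; rewrite hu => h.
have := logder_inj _ h (logder_lin 1) m; rewrite coefD coef1 coefZ coefX mulr0 addr0.
move=> /(_ erefl) e; apply: (@lreg_sign _ m); rewrite e exprS mulN1r opprK.
by rewrite mulr1.
Qed.

Lemma psum_zero (u : 'I_r -> {mpoly rat[b]}) m : (forall j, u j = 0) -> psum u m = 0.
Proof.
move=> hu; have := newton u.
have -> : genp u = 1 by rewrite /genp big1 ?addr0 // => i _; rewrite hu scale0r.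
move=> h; have := logder_inj _ h (@logder1 _) m; rewrite coef1 => /(_ erefl) e.
by apply: (@lreg_sign _ m); rewrite e mulr0.
Qed.

(* With e_1 = 1, e_(k+1) = (-1)^k and the other e_j zero, Newton's recursion  *)
(* has nonnegative coefficients.                                              *)
Lemma psum_trinomial (u : 'I_r -> {mpoly rat[b]}) k m : (0 < k < r)%N -> (k < m)%N ->
    (forall j : 'I_r, u j = if j == 0%N :> nat then 1 else if j == k :> nat then (-1) ^+ k else 0) ->
  exists N, psum u m = N.+2%:R.
Proof.
move=> /andP[k0 kr] km hu; set p := psum u.
have gu : genp u = 1 + 'X + (-1) ^+ k *: 'X^(k.+1).
  rewrite /genp (bigD1 (Ordinal r_gt0)) //= hu /= expr1 scale1r.
  rewrite (bigD1 (Ordinal kr)) -?(inj_eq val_inj) -?lt0n //= hu /= eqn0Ngt k0 eqxx.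
  rewrite big1 ?addr0 ?addrA // => i; rewrite -!(inj_eq val_inj) hu /=.
  by case/andP => /negbTE -> /negbTE ->; rewrite scale0r.
(* Coefficient i+1 of Newton's identity for 1 + T + (-1)^k T^(k+1), with all signs cancelled. The
   derivative contributes at i+1 = k only, where the term p (i - k) is still absent. *)
have rec i : p i.+1 = p i + (if i.+1 == k then k.+1%:R else
                             if (i < k)%N then 0 else p (i - k)%N).
  have := @logder_trunc _ _ _ i.+2 i.+1 (newton u) (leqnn _).
  rewrite gu !mulrDl mul1r -scalerAl -commr_polyXn coef_deriv !coefD.
  rewrite !coefZ coefXM coefMXn !coef_poly coef1 coefX coefXn /= !add0r.
  rewrite eqSS subSS -/p ltnS leqnn ltnS leqnSn ltnS ltnS (leq_trans (leq_subr _ _) (leqnSn _)).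
  move=> e; apply: (@lreg_sign _ i.+1); rewrite mulrDr.
  have {e} -> : (-1) ^+ i.+1 * p i.+1 = ((-1) ^+ k * (i.+1 == k)%:R) *+ i.+2
     - (-1) ^+ i * p i - (-1) ^+ k * (if (i < k)%N then 0 else (-1) ^+ (i - k) * p (i - k)%N).
    rewrite e; set X := _ * p i.+1; set Y := _ * p i; set Z := _ * (if _ then _ else _).
    by rewrite [X + Y + Z - Y]addrAC !addrK.
  rewrite exprS mulN1r !mulNr addrAC [RHS]addrC; congr (_ - _).
  have [ik|ik] := eqVneq i.+1 k.
    by rewrite -ik ltnSn !mulr0 subr0 mulr1 -mulr_natr exprS mulN1r mulNr.
  rewrite mulr0 mul0rn add0r; case: ltnP => ki; first by rewrite !mulr0 oppr0.
  by rewrite mulrA -exprD subnKC.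
have p0 : p 0%N = 1.
  have := newton u 0%N; rewrite gu coef_deriv !coefD !coefZ coef1 coefX coefXn /=.
  rewrite eqSS eq_sym eqn0Ngt k0 mulr0 addr0 add0r big_ord1 !coefD coef1 coefX coefZ coefXn.
  by rewrite mulr0 !addr0 !mul1r.
have pos i : exists N, p i = N.+1%:R.
  elim/ltn_ind: i => -[|i] IH; first by exists 0%N.
  have [N hN] := IH i (ltnSn i); rewrite rec hN.
  case: eqP => _; first by exists (N + k.+1)%N; rewrite -natrD addSn.
  case: ltnP => ki; first by exists N; rewrite addr0.
  have [|N' ->] := IH (i - k)%N; first by rewrite ltnS leq_subr.
  by exists (N + N'.+1)%N; rewrite -natrD addSn.
(* Beyond k the recursion adds two positive integers, so the value is at least 2 and in particular
   differs from 1. *)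
case: m km => // m; rewrite ltnS => km; rewrite -/p rec.
have [[N ->] [N' ->]] := (pos m, pos (m - k)%N).
rewrite gtn_eqF ?ltnS // ltnNge km /=.
by exists (N + N')%N; rewrite -natrD addSn addnS.
Qed.

End PowerSumValues.

(** * The rows of a trivalent vertex *)

Lemma cat2l (T : Type) a b (f : 'I_a -> T) (g : 'I_b -> T) i : cat2 f g (lshift b i) = f i.
Proof. by rewrite /cat2 (unsplitK (inl i)). Qed.

Lemma cat2r (T : Type) a b (f : 'I_a -> T) (g : 'I_b -> T) i : cat2 f g (rshift a i) = g i.
Proof. by rewrite /cat2 (unsplitK (inr i)). Qed.

Lemma cat2P a b (P : 'I_(a + b) -> Prop) :
  (forall i, P (lshift b i)) -> (forall i, P (rshift a i)) -> forall i, P i.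
Proof. by move=> hl hr i; case: (splitP i) => j ij; [rewrite (_ : i = lshift b j)
  | rewrite (_ : i = rshift a j)] => //; apply: val_inj. Qed.

Lemma quoP N (p q : {mpoly rat[N]}) : (exists c, c * q = p) -> quo p q * q = p.
Proof. exact: epsilon_spec. Qed.

Lemma whomog_genp_coef N (w : 'I_N -> nat) r (u : 'I_r -> {mpoly rat[N]}) k :
  (forall j : 'I_r, whomog w (2 * j.+1)%N (u j)) -> whomog w (2 * k)%N (genp u)`_k.
Proof.
move=> hu; case: k => [|k]; first by rewrite coef_genp0; apply: whomog1.
have [kr|rk] := ltnP k r; first by rewrite (coef_genp _ (Ordinal kr)); apply: hu.
rewrite /genp coefD coef1 coef_sum big1 ?addr0 => [|i _]; first exact: whomog0.
by rewrite coefZ coefXn eqSS gtn_eqF ?mulr0 // (leq_trans _ rk).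
Qed.

Lemma size_genp (B : comNzRingType) r (u : 'I_r -> B) : (size (genp u) <= r.+1)%N.
Proof.
apply/leq_sizeP => -[|k] //; rewrite ltnS => rk; rewrite /genp coefD coef1 coef_sum big1 ?addr0 // => i _.
by rewrite coefZ coefXn eqSS gtn_eqF ?mulr0 // (leq_trans _ rk).
Qed.

Lemma horner1_genp (B : comNzRingType) r (u : 'I_r -> B) : (genp u).[1] = 1 + \sum_j u j.
Proof.
rewrite /genp hornerD hornerC horner_sum; congr (_ + _); apply: eq_bigr => j _.
by rewrite hornerZ hornerXn expr1n mulr1.
Qed.

Section VertexTheory.
Variables n p q r : nat.
Notation A := {mpoly rat[p + q + r]}.
Hypothesis r_def : r = (p + q)%N.
Hypothesis p_gt0 : (0 < p)%N.
Hypothesis r_le : (r <= n)%N.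

Local Notation x := (@vx p q r).
Local Notation y := (@vy p q r).
Local Notation z := (@vz p q r).
Local Notation e := (@ve p q r).
Local Notation w := (@wV p q r).

Lemma whomog_vx (j : 'I_p) : whomog w (2 * j.+1)%N (x j).
Proof.
have -> : (2 * j.+1)%N = w (lshift r (lshift q j)) by rewrite /wV /cat3 !cat2l.
exact: whomogX.
Qed.

Lemma whomog_vy (j : 'I_q) : whomog w (2 * j.+1)%N (y j).
Proof.
have -> : (2 * j.+1)%N = w (lshift r (rshift p j)) by rewrite /wV /cat3 cat2l cat2r.
exact: whomogX.
Qed.

Lemma whomog_vz (j : 'I_r) : whomog w (2 * j.+1)%N (z j).
Proof.
have -> : (2 * j.+1)%N = w (rshift (p + q) j) by rewrite /wV /cat3 cat2r.
exact: whomogX.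
Qed.

(** At T = 1 the generating polynomials become the total classes; since coefficient k is homogeneous
    of weight 2k, the homogeneous component of weight 2(j+1) is exactly coefficient j+1. *)
Lemma veE j : e j = (genp x * genp y)`_j.+1.
Proof.
rewrite /ve -!horner1_genp -hornerM.
set P := genp x * genp y.
have hP k : P`_k \is (2 * k)%N.-homog for (wt w).
  apply/dhomogP => m mP; apply/eqP; rewrite -eqz_nat; apply/eqP; move: m mP.
  rewrite /P coefM; apply: whomog_sum => i _.
  have -> : (2 * k)%N%:Z = (2 * i)%N%:Z + (2 * (k - i))%N%:Z.
    by rewrite -PoszD -mulnDr subnKC // -ltnS.
  apply: whomogM; apply: whomog_genp_coef; [exact: whomog_vx | exact: whomog_vy].
(* The sum is padded so that the index j+1 occurs in it even when it exceeds the degree of P. *)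
have hS : (size P <= (size P + j).+2)%N by rewrite 2?leqW // leq_addr.
rewrite (horner_coef_wide _ hS) linear_sum /=.
have hj : (j.+1 < (size P + j).+2)%N by rewrite ltnS ltnS leq_addl.
rewrite (bigD1 (Ordinal hj)) //= expr1n mulr1 pihomog_dE // big1 ?addr0 // => i.
rewrite -(inj_eq val_inj) /= => ij; rewrite expr1n mulr1.
by apply: (pihomog_ne0 _ (hP i)); rewrite eqn_mul2l.
Qed.

Lemma whomog_ve (j : 'I_r) : whomog w (2 * j.+1)%N (e j).
Proof.
rewrite veE coefM; apply: whomog_sum => i _.
have -> : (2 * j.+1)%N%:Z = (2 * i)%N%:Z + (2 * (j.+1 - i))%N%:Z.
  by rewrite -PoszD -mulnDr subnKC // -ltnS.
apply: whomogM; apply: whomog_genp_coef; [exact: whomog_vx | exact: whomog_vy].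
Qed.

(** As r = p + q, the product has no coefficient beyond those that [ve] records. *)
Lemma genp_ve : genp e = genp x * genp y.
Proof.
apply/polyP => -[|k].
  by rewrite coef_genp0 coefM big_ord1 !coef_genp0 mulr1.
have [kr|rk] := ltnP k r; first by rewrite (coef_genp _ (Ordinal kr)) veE.
rewrite [LHS]nth_default ?[RHS]nth_default //.
  apply: leq_trans (size_polyMleq _ _) _.
  move: (size_genp x) (size_genp y) r_def rk.
  by clear r_le p_gt0; move: (size (genp x)) (size (genp y)); lia.
exact: leq_trans (size_genp _) _.
Qed.

Lemma genp_sub_ve b (f : 'I_(p + q + r) -> {mpoly rat[b]}) :
  genp (sub f \o e) = genp (sub f \o x) * genp (sub f \o y).
Proof. by rewrite -!map_genp -rmorphM -genp_ve. Qed.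

(* c is true for the splitting vertex *)
Definition vu (c : bool) : 'I_r -> A := if c then z else e.
Definition vv (c : bool) : 'I_r -> A := if c then e else z.
Definition vb c j := vv c j - vu c j.
Definition vdiff c (j : nat) := @Fr n p q r (mix j (vu c) (vv c)) - Fr n (mix j.+1 (vu c) (vv c)).
Definition va c (j : 'I_r) := quo (vdiff c j) (vb c j).

(** The two arguments of F differ only at index j, and there by [vb c j], so the quotient is
    exact. *)
Lemma vaP c j : va c j * vb c j = vdiff c j.
Proof.
apply: quoP; apply: sub_dvd => i; rewrite /mix ltnS.
case: ltngtP => [ij|ij|/val_inj ->]; try by exists 0; rewrite mul0r subrr.
by exists 1; rewrite mul1r.
Qed.

Lemma whomog_vu c (j : 'I_r) : whomog w (2 * j.+1)%N (vu c j).
Proof. by case: c; [exact: whomog_vz | exact: whomog_ve]. Qed.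

Lemma whomog_vv c (j : 'I_r) : whomog w (2 * j.+1)%N (vv c j).
Proof. by case: c; [exact: whomog_ve | exact: whomog_vz]. Qed.

Lemma whomog_vb c (j : 'I_r) : whomog w (2 * j.+1)%N (vb c j).
Proof. by apply: whomogB; [exact: whomog_vv | exact: whomog_vu]. Qed.

Lemma whomog_Fr (u : 'I_r -> A) :
  (forall j : 'I_r, whomog w (2 * j.+1)%N (u j)) -> whomog w (2 * n.+1)%N (Fr n u).
Proof. exact: whomog_psum. Qed.

Lemma whomog_mix c k (j : 'I_r) : whomog w (2 * j.+1)%N (mix k (vu c) (vv c) j).
Proof. by rewrite /mix; case: ifP => _; [exact: whomog_vu | exact: whomog_vv]. Qed.

Lemma sub_Fr b (f : 'I_(p + q + r) -> {mpoly rat[b]}) u :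
  sub f (@Fr n p q r u) = psum (sub f \o u) n.
Proof. exact: sub_sub. Qed.

Section Evaluation.
Variables (b : nat) (x' : 'I_p -> {mpoly rat[b]}) (y' : 'I_q -> {mpoly rat[b]})
  (z' : 'I_r -> {mpoly rat[b]}).
Let ev := cat3 x' y' z'.

Lemma sub_vx : sub ev \o x =1 x'.
Proof. by move=> j; rewrite /= subX /ev /cat3 !cat2l. Qed.

Lemma sub_vy : sub ev \o y =1 y'.
Proof. by move=> j; rewrite /= subX /ev /cat3 cat2l cat2r. Qed.

Lemma sub_vz : sub ev \o z =1 z'.
Proof. by move=> j; rewrite /= subX /ev /cat3 cat2r. Qed.

Lemma genp_ev_ve : genp (sub ev \o e) = genp x' * genp y'.
Proof. by rewrite genp_sub_ve (eq_genp sub_vx) (eq_genp sub_vy). Qed.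

End Evaluation.

(** Specialize the thin edges to 0 and all z_j to 1. *)
Lemma vb_neq0 c j : vb c j != 0.
Proof.
have r0 : (0 < r)%N by rewrite r_def addn_gt0 p_gt0.
pose ev := @cat3 {mpoly rat[0]} p q r (fun=> 0) (fun=> 0) (fun=> 1).
have ez : sub ev (z j) = 1 by exact: sub_vz.
have ee : sub ev (e j) = 0.
  have := genp_ev_ve (fun=> 0) (fun=> 0) (fun=> 1 : {mpoly rat[0]}).
  have g0 k : genp (fun _ : 'I_k => 0 : {mpoly rat[0]}) = 1.
    by rewrite /genp big1 ?addr0 // => i _; rewrite scale0r.
  by rewrite !g0 mulr1 -(g0 r) => /genp_inj/(_ j).
apply/eqP => /(congr1 (sub ev)); rewrite /vb rmorphB rmorph0 /vv /vu.
case: c => /=; rewrite ez ee ?sub0r ?subr0; last by move/eqP; rewrite oner_eq0.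
by move/eqP; rewrite oppr_eq0 oner_eq0.
Qed.

(** Specialize the thin edges so that the product of their total classes is 1 + T, and choose z' so
    that the two arguments of F become, in some order, z' and the coefficients of 1 + T. All power
    sums of the latter are 1. For j = 0 take z' = 0, with power sum 0; for j > 0 add (-1)^j at index
    j, where [psum_trinomial] gives a value of at least 2 since j < r <= n. *)
Lemma vdiff_neq0 c (j : 'I_r) : vdiff c j != 0.
Proof.
have r0 : (0 < r)%N by rewrite r_def addn_gt0 p_gt0.
pose d k (i : 'I_k) : {mpoly rat[0]} := (i == 0%N :> nat)%:R.
pose z' (i : 'I_r) : {mpoly rat[0]} :=
  if (0 < j)%N then if i == 0%N :> nat then 1 else if i == j :> nat then (-1) ^+ j else 0 else 0.
pose ev := cat3 (@d p) (fun _ : 'I_q => 0) z'.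
have ez i : sub ev (z i) = z' i by exact: sub_vz.
have ee i : sub ev (e i) = d r i.
  have := genp_ev_ve (@d p) (fun=> 0) z'; rewrite (genp_delta0 p_gt0) //.
  rewrite [X in _ * X](_ : _ = 1); last by rewrite /genp big1 ?addr0 // => k _; rewrite scale0r.
  by rewrite mulr1 -(@genp_delta0 _ _ r0 (@d r)) // => /genp_inj/(_ i).
have d1 : psum (@d r) n = 1 by exact: psum_delta0.
have evmix k : sub ev \o mix k (vu c) (vv c) =1 mix k (sub ev \o vu c) (sub ev \o vv c).
  by move=> i; rewrite /mix /=; case: ifP.
have [j0|j0] := posnP j.
  have z0 : psum (fun _ : 'I_r => 0 : {mpoly rat[0]}) n = 0 by exact: psum_zero.
  rewrite /psum in d1 z0.
  apply/eqP => /(congr1 (sub ev)); rewrite /vdiff rmorphB rmorph0 /= !sub_Fr /psum.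
  rewrite !(eq_sub (evmix _)) j0; case: c {evmix}; rewrite /vu /vv.
    rewrite (@eq_sub _ _ _ (@d r)) => [|i]; last by rewrite /mix /= ee.
    rewrite [X in _ - X](@eq_sub _ _ _ (fun=> 0)) => [|i]; last first.
      rewrite /mix /= ee ez /z' j0 /d ltnS leqn0; by case: eqP.
    by move/eqP; rewrite d1 z0 subr0 oner_eq0.
  rewrite (@eq_sub _ _ _ (fun=> 0)) => [|i]; last by rewrite /mix /= ez /z' j0.
  rewrite [X in _ - X](@eq_sub _ _ _ (@d r)) => [|i]; last first.
    rewrite /mix /= ee ez /z' j0 /d ltnS leqn0; by case: eqP.
  by move/eqP; rewrite d1 z0 sub0r oppr_eq0 oner_eq0.
have jn : (j < n)%N by apply: leq_trans r_le.
have jr : (0 < j < r)%N by rewrite j0 /=.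
have [i|N hN] := @psum_trinomial 0 r r0 z' j n jr jn; first by rewrite /z' j0.
apply/eqP => /(congr1 (sub ev)); rewrite /vdiff rmorphB rmorph0 /= !sub_Fr /psum.
have N1 : psum z' n - 1 != 0 by rewrite hN -[N.+2]addn1 natrD addrK natr_mpoly_eq0.
rewrite /psum in d1 N1.
rewrite !(eq_sub (evmix _)); case: c {evmix}; rewrite /vu /vv.
  rewrite (@eq_sub _ _ _ (@d r)) => [|i]; last first.
    by rewrite /mix /= ee ez /z' j0 /d; case: ltngtP => //; case: eqP => // ->; case: eqP.
  rewrite [X in _ - X](@eq_sub _ _ _ z') => [|i]; last first.
    rewrite /mix /= ee ez /z' j0 /d ltnS; case: ltngtP => // ji.
    by rewrite gtn_eqF // (leq_ltn_trans _ ji).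
  by move/eqP; rewrite d1 -oppr_eq0 opprB (negbTE N1).
rewrite (@eq_sub _ _ _ z') => [|i]; last first.
  by rewrite /mix /= ee ez /z' j0 /d; case: ltngtP => //; case: eqP.
rewrite [X in _ - X](@eq_sub _ _ _ (@d r)) => [|i]; last first.
  rewrite /mix /= ee ez /z' j0 /d ltnS; case: ltngtP => // ji.
  by rewrite gtn_eqF // (leq_ltn_trans _ ji).
by move/eqP; rewrite d1 (negbTE N1).
Qed.

Lemma whomog_vdiff c j : whomog w (2 * n.+1)%N (vdiff c j).
Proof. by apply: whomogB; apply: whomog_Fr => i; apply: whomog_mix. Qed.

Lemma whomog_va c (j : 'I_r) : whomog w ((2 * n.+1)%N%:Z - (2 * j.+1)%N%:Z) (va c j).
Proof.
refine (whomog_quo (vb_neq0 c j) (@whomog_vb c j) _).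
by rewrite vaP subrK; apply: whomog_vdiff.
Qed.

Lemma va_neq0 c j : va c j != 0.
Proof. by apply: contraNneq (vdiff_neq0 c j) => a0; rewrite -vaP a0 mul0r. Qed.

(** The entries have degrees 2(j+1) and 2(n+1) - 2(j+1); half the difference depends only on n and
    j, hence not on the vertex. *)
Lemma vrow_shift c (j : 'I_r) :
  (((wdeg w (vb c j))%:Z - (wdeg w (va c j))%:Z) %/ 2)%Z = (2 * j.+1)%N%:Z - n.+1%:Z.
Proof.
have jn : (j < n.+1)%N by rewrite (leq_trans (ltn_ord j)) // (leq_trans r_le).
rewrite (wdeg_whomog (vb_neq0 c j) (@whomog_vb c j)).
have := @whomog_va c j; rewrite subzn ?leq_mul2l // => h.
rewrite (wdeg_whomog (va_neq0 c j) h).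
have -> : (2 * j.+1)%N%:Z - (2 * n.+1 - 2 * j.+1)%N%:Z = ((2 * j.+1)%N%:Z - n.+1%:Z) * 2.
  by rewrite -subzn ?leq_mul2l // !PoszM; ring.
by rewrite mulzK.
Qed.

Lemma sum_vdiff c : \sum_(j < r) vdiff c j = Fr n (vv c) - Fr n (vu c).
Proof.
transitivity (\sum_(0 <= j < r) (Fr n (mix j (vu c) (vv c)) - Fr n (mix j.+1 (vu c) (vv c)))).
  by rewrite big_mkord.
rewrite (@telescope_sumr_eq _ 0 r (fun j => - Fr n (mix j (vu c) (vv c)))) // => [|j _].
  rewrite opprK addrC; congr (_ - _); apply: eq_sub => i; rewrite /mix ?ltn_ord //.
by rewrite opprK addrC.
Qed.

Lemma Fr_ve : Fr n e = psum x n + psum y n.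
Proof. exact: psum_genpM genp_ve. Qed.

End VertexTheory.

Arguments vu {p q r} c.
Arguments vv {p q r} c.
Arguments vb {p q r} c j.
Arguments va n {p q r} c j.
Arguments vdiff n {p q r} c j.

(** * Factorizations of finite rank up to reindexing of their bases *)

(** Unlike in [koszul], the shift is a parameter, so that it is preserved by substitutions without
    recomputing the degrees of the entries. *)
Definition krow N (a b : {mpoly rat[N]}) (s : int) : fmfact N :=
  @FMFact N 1 1 (fun=> 0) (fun=> s) a%:M b%:M.

Definition fmap a b (f : {mpoly rat[a]} -> {mpoly rat[b]}) (M : fmfact a) : fmfact b :=
  @FMFact b _ _ (@fsh0 a M) (@fsh1 a M) (map_mx f (fmx0 M)) (map_mx f (fmx1 M)).

Definition has_pot N (M : fmfact N) (om : {mpoly rat[N]}) :=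
  fmx1 M *m fmx0 M = om%:M /\ fmx0 M *m fmx1 M = om%:M.

(** [h] is the common degree of the two differentials, half the degree of the potential; it is n+1
    for the vertices. *)
Definition homog_mf N (w : 'I_N -> nat) (h : int) (M : fmfact N) :=
  (forall i j, whomog w (h + fsh0 j - fsh1 i) (fmx0 M i j)) /\
  (forall i j, whomog w (h + fsh1 j - fsh0 i) (fmx1 M i j)).

Lemma tens_scalar11 (R : comPzRingType) m n (a b : R) :
  (a%:M : 'M_m) *t (b%:M : 'M_n) = (a * b)%:M.
Proof.
apply/matrixP => i j; case: (mxtens_indexP i) => i1 i2; case: (mxtens_indexP j) => j1 j2.
rewrite tensmxE !mxE (can_eq (@mxtens_indexK m n)) xpair_eqE.
by do 2 case: eqP => _; rewrite ?mulr0n ?mulr1n ?mulr0 ?mul0r.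
Qed.

Lemma ftens_pot N (M P : fmfact N) a b :
  has_pot M a -> has_pot P b -> has_pot (ftens M P) (a + b).
Proof.
move=> [M10 M01] [P10 P01]; split; rewrite /= mulmx_block !(mulmxN, mulNmx, opprK);
  rewrite !tensmx_mul !mul1mx !mulmx1 M10 M01 P10 P01 !tens_scalar11 !mulr1 !mul1r.
  by rewrite -!raddfD /= !addNr [b + a]addrC scalar_mx_block.
by rewrite !subrr -!raddfD /= [b + a]addrC scalar_mx_block.
Qed.

Lemma krow_pot N (a b : {mpoly rat[N]}) s : has_pot (krow a b s) (a * b).
Proof. by split; rewrite /= -scalar_mxM // mulrC. Qed.

Lemma funit_pot N : has_pot (funit N) 0.
Proof. by split; rewrite /= ?mulmx0 ?mul0mx ?raddf0 //; apply/matrixP => -[]. Qed.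

Lemma fmap_pot a b (f : {rmorphism {mpoly rat[a]} -> {mpoly rat[b]}}) M om :
  has_pot M om -> has_pot (fmap f M) (f om).
Proof. by move=> [h1 h2]; split; rewrite /= -map_mxM ?h1 ?h2 map_scalar_mx. Qed.

Lemma fshift_pot N m (M : fmfact N) om : has_pot M om -> has_pot (fshift m M) om.
Proof. by []. Qed.

Section Index.
Variables a b c d : nat.

(** Labelling the basis of a tensor product by a sum of products of indices reduces identities
    between block Kronecker matrices to a case analysis on entries. *)
Definition ix (x : 'I_a * 'I_b + 'I_c * 'I_d) : 'I_(a * b + c * d) :=
  match x with
  | inl p => lshift _ (mxtens_index p)
  | inr p => rshift _ (mxtens_index p)
  end.

Lemma ix_inj : injective ix.
Proof.
move=> [p|p] [q|q] /= /eqP.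
- by rewrite eq_lshift (can_eq (@mxtens_indexK _ _)) => /eqP ->.
- by rewrite eq_lrshift.
- by rewrite eq_rlshift.
- by rewrite eq_rshift (can_eq (@mxtens_indexK _ _)) => /eqP ->.
Qed.

Lemma ixP (P : 'I_(a * b + c * d) -> Prop) : (forall x, P (ix x)) -> forall i, P i.
Proof.
move=> h; apply: cat2P => i; case: (mxtens_indexP i) => i1 i2.
  exact: (h (inl (i1, i2))).
exact: (h (inr (i1, i2))).
Qed.

End Index.

(* injection would unfold the indices themselves *)
Lemma inl_pairI A B C (a a' : A) (b b' : B) :
  inl C (a, b) = inl (a', b') -> a = a' /\ b = b'.
Proof. by case. Qed.

Lemma inr_pairI A B C (a a' : A) (b b' : B) :
  inr C (a, b) = inr (a', b') -> a = a' /\ b = b'.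
Proof. by case. Qed.

Lemma sum_eqE (A B : eqType) :
  ((forall x y : A, ((inl x : A + B) == inl y) = (x == y)) *
   (forall x y : B, ((inr x : A + B) == inr y) = (x == y)) *
   (forall x y, ((inl x : A + B) == inr y) = false) *
   (forall x y, ((inr x : A + B) == inl y) = false))%type.
Proof. by []. Qed.

Section TensorEntries.
Variables (N : nat) (M P : fmfact N).

Lemma fmx0_ftens x y : fmx0 (ftens M P) (ix y) (ix x) =
  match y, x with
  | inl (i', j'), inl (i, j) => fmx0 M i' i * (j' == j)%:R
  | inl (i', j'), inr (i, j) => - ((i' == i)%:R * fmx1 P j' j)
  | inr (i', j'), inl (i, j) => (i' == i)%:R * fmx0 P j' j
  | inr (i', j'), inr (i, j) => fmx1 M i' i * (j' == j)%:R
  end.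
Proof.
case: x => -[i j]; case: y => -[i' j'];
  rewrite /= ?(block_mxEul, block_mxEur, block_mxEdl, block_mxEdr);
  by rewrite ?[(- _ : 'M_(_, _)) _ _]mxE tensmxE !mxE.
Qed.

Lemma fmx1_ftens x y : fmx1 (ftens M P) (ix y) (ix x) =
  match y, x with
  | inl (i', j'), inl (i, j) => fmx1 M i' i * (j' == j)%:R
  | inl (i', j'), inr (i, j) => (i' == i)%:R * fmx1 P j' j
  | inr (i', j'), inl (i, j) => - ((i' == i)%:R * fmx0 P j' j)
  | inr (i', j'), inr (i, j) => fmx0 M i' i * (j' == j)%:R
  end.
Proof.
case: x => -[i j]; case: y => -[i' j'];
  rewrite /= ?(block_mxEul, block_mxEur, block_mxEdl, block_mxEdr);
  by rewrite ?[(- _ : 'M_(_, _)) _ _]mxE tensmxE !mxE.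
Qed.

Lemma fsh0_ftens x : fsh0 (f := ftens M P) (ix x) =
  match x with
  | inl (i, j) => fsh0 i + fsh0 j
  | inr (i, j) => fsh1 i + fsh1 j
  end.
Proof.
by case: x => -[i j]; rewrite /= ?cat2l ?cat2r /tens_sh mxtens_indexK.
Qed.

Lemma fsh1_ftens x : fsh1 (f := ftens M P) (ix x) =
  match x with
  | inl (i, j) => fsh1 i + fsh0 j
  | inr (i, j) => fsh0 i + fsh1 j
  end.
Proof.
by case: x => -[i j]; rewrite /= ?cat2l ?cat2r /tens_sh mxtens_indexK.
Qed.

End TensorEntries.

Lemma whomog_delta N (w : 'I_N -> nat) (T : eqType) (i j : T) d p :
  (i = j -> whomog w d p) -> whomog w d (p * (i == j)%:R).
Proof.
by move=> h; case: eqP => [/h|_]; rewrite ?mulr1 // mulr0 => *; apply: whomog0.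
Qed.

Lemma whomog_deltal N (w : 'I_N -> nat) (T : eqType) (i j : T) d p :
  (i = j -> whomog w d p) -> whomog w d ((i == j)%:R * p).
Proof. by rewrite mulrC; apply: whomog_delta. Qed.

Lemma homog_ftens N (w : 'I_N -> nat) h (M P : fmfact N) :
  homog_mf w h M -> homog_mf w h P -> homog_mf w h (ftens M P).
Proof.
move=> [M0 M1] [P0 P1]; split; apply: ixP => y; apply: ixP => x.
  rewrite fmx0_ftens fsh1_ftens fsh0_ftens; case: x y => -[i j] -[] [i' j'].
  - apply: whomog_delta => ->; have := M0 i' i; congr (whomog _ _ _); ring.
  - apply: whomog_deltal => ->; have := P0 j' j; congr (whomog _ _ _); ring.
  - apply/whomogN/whomog_deltal => ->; have := P1 j' j; congr (whomog _ _ _); ring.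
  - apply: whomog_delta => ->; have := M1 i' i; congr (whomog _ _ _); ring.
rewrite fmx1_ftens fsh1_ftens fsh0_ftens; case: x y => -[i j] -[] [i' j'].
- apply: whomog_delta => ->; have := M1 i' i; congr (whomog _ _ _); ring.
- apply/whomogN/whomog_deltal => ->; have := P0 j' j; congr (whomog _ _ _); ring.
- apply: whomog_deltal => ->; have := P1 j' j; congr (whomog _ _ _); ring.
- apply: whomog_delta => ->; have := M0 i' i; congr (whomog _ _ _); ring.
Qed.

Lemma homog_krow N (w : 'I_N -> nat) h a b s :
  whomog w (h - s) a -> whomog w (h + s) b -> homog_mf w h (krow a b s).
Proof.
by move=> ha hb; split=> i j; rewrite /= !ord1 mxE mulr1n ?addr0 ?subr0.
Qed.

Lemma homog_funit N (w : 'I_N -> nat) h : homog_mf w h (funit N).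
Proof. by split=> -[? ?] //= [? ?]. Qed.

Lemma homog_fshift N (w : 'I_N -> nat) h m M : homog_mf w h M -> homog_mf w h (fshift m M).
Proof.
move=> [M0 M1]; split=> i j /=.
  have := M0 i j; congr (whomog _ _ _); ring.
have := M1 i j; congr (whomog _ _ _); ring.
Qed.

Lemma homog_fmap a b (w : 'I_a -> nat) (w' : 'I_b -> nat) h f M :
  (forall k p, whomog w k p -> whomog w' k (f p)) -> homog_mf w h M -> homog_mf w' h (fmap f M).
Proof. by move=> hf [M0 M1]; split=> i j /=; rewrite mxE; apply: hf. Qed.

Section FmapTensor.
Variables (a b : nat) (f : {rmorphism {mpoly rat[a]} -> {mpoly rat[b]}}).

Lemma fmap_ftens M P : fmap f (ftens M P) = ftens (fmap f M) (fmap f P).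
Proof.
by rewrite /fmap /ftens /= !map_block_mx !map_mxN !map_mxT !map_mx1.
Qed.

Lemma fmap_funit : fmap f (funit a) = funit b.
Proof. by rewrite /fmap /funit /= !map_mx0. Qed.

Lemma fmap_krow x y s : fmap f (krow x y s) = krow (f x) (f y) s.
Proof. by rewrite /fmap /krow /= !map_scalar_mx. Qed.

End FmapTensor.

Section Nesting.
Variables a a' b b' c c' : nat.

(* The triples of indices in a triple tensor product, sorted by parities. *)
Definition nest : finType :=
  (('I_a * 'I_b * 'I_c + 'I_a * 'I_b' * 'I_c') +
   ('I_a' * 'I_b' * 'I_c + 'I_a' * 'I_b * 'I_c'))%type.

Definition nestr (t : nest) : 'I_(a * (b * c + b' * c') + a' * (b' * c + b * c')) :=
  match t with
  | inl (inl (i, j, k)) => ix (inl (i, ix (inl (j, k))))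
  | inl (inr (i, j, k)) => ix (inl (i, ix (inr (j, k))))
  | inr (inl (i, j, k)) => ix (inr (i, ix (inl (j, k))))
  | inr (inr (i, j, k)) => ix (inr (i, ix (inr (j, k))))
  end.

Definition nestl (t : nest) : 'I_((a * b + a' * b') * c + (a' * b + a * b') * c') :=
  match t with
  | inl (inl (i, j, k)) => ix (inl (ix (inl (i, j)), k))
  | inl (inr (i, j, k)) => ix (inr (ix (inr (i, j)), k))
  | inr (inl (i, j, k)) => ix (inl (ix (inr (i, j)), k))
  | inr (inr (i, j, k)) => ix (inr (ix (inl (i, j)), k))
  end.

Lemma nestr_inj : injective nestr.
Proof.
case=> -[] [[i j] k] [] [] [[i' j'] k'] /ix_inj // E.
all: first [have [-> {}E] := inl_pairI E | have [-> {}E] := inr_pairI E].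
all: move/ix_inj: E => // E.
all: first [have [-> ->] := inl_pairI E | have [-> ->] := inr_pairI E].
all: by [].
Qed.

Lemma nestl_inj : injective nestl.
Proof.
case=> -[] [[i j] k] [] [] [[i' j'] k'] /ix_inj // E.
all: first [have [{}E ->] := inl_pairI E | have [{}E ->] := inr_pairI E].
all: move/ix_inj: E => // E.
all: first [have [-> ->] := inl_pairI E | have [-> ->] := inr_pairI E].
all: by [].
Qed.

End Nesting.

(** * Associativity, unit and block form of tensor products, up to relabelling of bases *)

Section Reindexing.
Variable N : nat.
Implicit Types M P Q : fmfact N.

Definition fiso M P : Prop :=
  exists (u0 : 'I_(frk0 M) -> 'I_(frk0 P)) (u1 : 'I_(frk1 M) -> 'I_(frk1 P)),
    [/\ bijective u0 /\ bijective u1,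
        forall i, fsh0 (u0 i) = fsh0 i, forall i, fsh1 (u1 i) = fsh1 i,
        forall i j, fmx0 P (u1 i) (u0 j) = fmx0 M i j
      & forall i j, fmx1 P (u0 i) (u1 j) = fmx1 M i j].

Lemma fiso_by M P (T0 T1 : finType)
    (v0 : T0 -> 'I_(frk0 M)) (v1 : T1 -> 'I_(frk1 M))
    (v0' : T0 -> 'I_(frk0 P)) (v1' : T1 -> 'I_(frk1 P)) :
    [/\ injective v0, injective v1, injective v0' & injective v1'] ->
    [/\ #|T0| = frk0 M, #|T1| = frk1 M, #|T0| = frk0 P & #|T1| = frk1 P] ->
    (forall i, fsh0 (v0' i) = fsh0 (v0 i)) -> (forall i, fsh1 (v1' i) = fsh1 (v1 i)) ->
    (forall i j, fmx0 P (v1' i) (v0' j) = fmx0 M (v1 i) (v0 j)) ->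
    (forall i j, fmx1 P (v0' i) (v1' j) = fmx1 M (v0 i) (v1 j)) ->
  fiso M P.
Proof.
move=> [i0 i1 i0' i1'] [c0 c1 c0' c1'] s0 s1 m0 m1.
have bij (T : finType) n (v : T -> 'I_n) : injective v -> #|T| = n -> bijective v.
  by move=> vi Tn; apply: inj_card_bij; rewrite // card_ord Tn.
have [v0i v0K v0iK] := bij _ _ _ i0 c0; have [v1i v1K v1iK] := bij _ _ _ i1 c1.
exists (v0' \o v0i), (v1' \o v1i); split.
- split; apply: bij_comp; try exact: bij; [by exists v0 | by exists v1].
- by move=> i; rewrite /= s0 v0iK.
- by move=> i; rewrite /= s1 v1iK.
- by move=> i j; rewrite /= m0 v0iK v1iK.
- by move=> i j; rewrite /= m1 v0iK v1iK.
Qed.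

(** With these sign conventions rebracketing needs no sign, so relabelling the basis triples
    suffices. *)
Lemma ftensA M P Q : fiso (ftens M (ftens P Q)) (ftens (ftens M P) Q).
Proof.
pose n0 := nest (frk0 M) (frk1 M) (frk0 P) (frk1 P) (frk0 Q) (frk1 Q).
(* The odd part has the shape of the even part with the two parities of M exchanged. *)
pose n1 := nest (frk1 M) (frk0 M) (frk0 P) (frk1 P) (frk0 Q) (frk1 Q).
apply: (@fiso_by (ftens M (ftens P Q)) (ftens (ftens M P) Q) n0 n1 (@nestr _ _ _ _ _ _)
  (@nestr _ _ _ _ _ _) (@nestl _ _ _ _ _ _) (@nestl _ _ _ _ _ _)).
- by split; [apply: nestr_inj | apply: nestr_inj | apply: nestl_inj | apply: nestl_inj].
- by split; rewrite !(card_sum, card_prod, card_ord) /=; ring.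
- by case=> -[] [[i j] k]; rewrite /nestl /nestr ?(fsh0_ftens, fsh1_ftens) addrA.
- by case=> -[] [[i j] k]; rewrite /nestl /nestr ?(fsh0_ftens, fsh1_ftens) addrA.
- case=> -[] [[i' j'] k'] -[] [] [[i j] k]; rewrite /nestl /nestr;
    rewrite !(fmx0_ftens, fmx1_ftens) ?(inj_eq (@ix_inj _ _ _ _)) ?sum_eqE ?xpair_eqE;
    by rewrite -?mulnb ?natrM /=; ring.
- case=> -[] [[i' j'] k'] -[] [] [[i j] k]; rewrite /nestl /nestr;
    rewrite !(fmx0_ftens, fmx1_ftens) ?(inj_eq (@ix_inj _ _ _ _)) ?sum_eqE ?xpair_eqE;
    by rewrite -?mulnb ?natrM /=; ring.
Qed.

Lemma ftens_funit M : fiso M (ftens M (funit N)).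
Proof.
apply: (@fiso_by M (ftens M (funit N)) 'I_(frk0 M) 'I_(frk1 M) id id
  (fun i => ix (inl (i, ord0))) (fun i => ix (inl (i, ord0)))).
- by split=> // i j /ix_inj E; have [->] := inl_pairI E.
- by split; rewrite card_ord //=; ring.
- by move=> i; rewrite fsh0_ftens addr0.
- by move=> i; rewrite fsh1_ftens addr0.
- by move=> i j; rewrite fmx0_ftens mulr1.
- by move=> i j; rewrite fmx1_ftens mulr1.
Qed.

(** The tensor product of M with a Koszul row, with the trivial index of rank one removed. *)
Definition cone M (a b : {mpoly rat[N]}) (s : int) : fmfact N :=
  @FMFact N (frk0 M + frk1 M) (frk1 M + frk0 M)
    (cat2 (@fsh0 N M) (fun i => @fsh1 N M i + s))
    (cat2 (@fsh1 N M) (fun i => @fsh0 N M i + s))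
    (block_mx (fmx0 M) (- b%:M) a%:M (fmx1 M))
    (block_mx (fmx1 M) b%:M (- a%:M) (fmx0 M)).

Lemma ftens_row M a b s : fiso (ftens M (krow a b s)) (cone M a b s).
Proof.
pose v c d (i : 'I_c + 'I_d) : 'I_(c * 1 + d * 1) :=
  match i with inl j => ix (inl (j, ord0)) | inr j => ix (inr (j, ord0)) end.
pose v' c d (i : 'I_c + 'I_d) : 'I_(c + d) :=
  match i with inl j => lshift d j | inr j => rshift c j end.
have vi c d : injective (v c d).
  by move=> [i|i] [j|j] /ix_inj // E; [have [->] := inl_pairI E | have [->] := inr_pairI E].
have vi' c d : injective (v' c d).
  move=> [i|i] [j|j] /eqP; rewrite /= ?(eq_lshift, eq_rshift, eq_lrshift, eq_rlshift) //;
    by move/eqP ->.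
apply: (@fiso_by (ftens M (krow a b s)) (cone M a b s) _ _ (v _ _) (v _ _) (v' _ _) (v' _ _)).
- by split; [apply: vi | apply: vi | apply: vi' | apply: vi'].
- by split; rewrite !(card_sum, card_ord) //=; ring.
- by case=> i; rewrite fsh0_ftens /v' /= ?(cat2l, cat2r) ?addr0.
- by case=> i; rewrite fsh1_ftens /v' /= ?(cat2l, cat2r) ?addr0.
- case=> i [] j; rewrite fmx0_ftens /v' /= ?(block_mxEul, block_mxEur, block_mxEdl, block_mxEdr).
  + by rewrite mulr1.
  + by rewrite !mxE mulr1n mulr_natl.
  + by rewrite !mxE mulr1n mulr_natl.
  + by rewrite mulr1.
- case=> i [] j; rewrite fmx1_ftens /v' /= ?(block_mxEul, block_mxEur, block_mxEdl, block_mxEdr).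
  + by rewrite mulr1.
  + by rewrite !mxE mulr1n mulr_natl.
  + by rewrite !mxE mulr1n mulr_natl.
  + by rewrite mulr1.
Qed.

End Reindexing.

Lemma ftens_fshift N m m' (M P : fmfact N) :
  ftens (fshift m M) (fshift m' P) = ftens (fshift (m + m') M) P.
Proof.
have e a b c d (s : 'I_a -> int) (t : 'I_b -> int) (s' : 'I_c -> int) (t' : 'I_d -> int) :
    cat2 (tens_sh (fun i => s i + m) (fun i => t i + m'))
         (tens_sh (fun i => s' i + m) (fun i => t' i + m'))
  = cat2 (tens_sh (fun i => s i + (m + m')) t) (tens_sh (fun i => s' i + (m + m')) t').
  by apply: functional_extensionality => i; rewrite /cat2; case: split => j; rewrite /tens_sh; ring.
by rewrite /ftens /= !e.
Qed.

Lemma fshift0 N (M : fmfact N) : fshift 0 M = M.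
Proof.
case: M => k0 k1 s0 s1 m0 m1; rewrite /fshift /=; congr FMFact;
  by apply: functional_extensionality => i; rewrite addr0.
Qed.

(** * Homotopy equivalences *)

Definition mklin (R : pzRingType) (U V : lmodType R) (f : U -> V) (fl : linear f) :
  {linear U -> V} := HB.pack f (GRing.isLinear.Build R U V *:%R f fl).

Lemma restr_linear (R S S' : pzRingType) (phi : {rmorphism R -> S})
    (phi' : {rmorphism R -> S'}) (U : lmodType S) (V : lmodType S') (f : U -> V) :
  (forall r u v, f (phi r *: u + v) = phi' r *: f u + f v) ->
  linear (f : restr phi U -> restr phi' V).
Proof. by move=> h r u v; exact: h. Qed.

Section HomotopyEquivalence.
Variable N : nat.
Implicit Types A B C : mfact N.

(** The equivalence part of [hmf_iso], separated from the freeness and potential conditions so that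
    it can be chained through intermediate factorizations. *)
Definition heq A B : Prop := exists (f : mf_hom A B) (g : mf_hom B A),
  mf_homotopic (mf_comp g f) (mf_id A) /\ mf_homotopic (mf_comp f g) (mf_id B).

Lemma heq_sym A B : heq A B -> heq B A.
Proof. by move=> [f [g [h1 h2]]]; exists g, f. Qed.

Lemma homotopic_comp_id A B C (f : mf_hom A B) (g : mf_hom B A)
    (f' : mf_hom B C) (g' : mf_hom C B) :
  mf_homotopic (mf_comp g f) (mf_id A) -> mf_homotopic (mf_comp g' f') (mf_id B) ->
  mf_homotopic (mf_comp (mf_comp g g') (mf_comp f' f)) (mf_id A).
Proof.
move=> [h0 [h1 [e0 e1]]] [k0 [k1 [l0 l1]]].
(* From g g' f' f - 1 = g (g' f' - 1) f + (g f - 1), the homotopy is g k f + h. *)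
have lin0 : linear (fun v => mfh1 g (k0 (mfh0 f v)) + h0 v).
  by move=> a u v; rewrite !linearP scalerDr addrACA.
have lin1 : linear (fun v => mfh0 g (k1 (mfh1 f v)) + h1 v).
  by move=> a u v; rewrite !linearP scalerDr addrACA.
exists (mklin lin0), (mklin lin1); split=> v /=.
  have := e0 v; have := congr1 (mfh0 g) (l0 (mfh0 f v)); rewrite /= linearB linearD /= => e e'.
  rewrite -(subrKA (mfh0 g (mfh0 f v))) e e' linearD -mfh_d1 mfh_d0 addrACA; congr (_ + _).
have := e1 v; have := congr1 (mfh1 g) (l1 (mfh1 f v)); rewrite /= linearB linearD /= => e e'.
rewrite -(subrKA (mfh1 g (mfh1 f v))) e e' linearD -mfh_d0 mfh_d1 addrACA; congr (_ + _).
Qed.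

Lemma heq_trans A B C : heq A B -> heq B C -> heq A C.
Proof.
move=> [f [g [gf fg]]] [f' [g' [gf' fg']]].
exists (mf_comp f' f), (mf_comp g g'); split; first exact: homotopic_comp_id.
exact: homotopic_comp_id.
Qed.

Lemma homotopic_eq A B (f g : mf_hom A B) :
  mfh0 f =1 mfh0 g -> mfh1 f =1 mfh1 g -> mf_homotopic f g.
Proof.
by move=> e0 e1; exists \0, \0; split=> v; rewrite ?e0 ?e1 subrr /= ?raddf0 addr0.
Qed.

End HomotopyEquivalence.

Section RestrictedMaps.
Variables (M N : nat) (phi : {rmorphism {mpoly rat[M]} -> {mpoly rat[N]}}) (w : 'I_N -> nat).

Lemma fiso_heq (A B : fmfact N) : fiso A B ->
  heq (restr_mfact phi (mfact_of w A)) (restr_mfact phi (mfact_of w B)).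
Proof.
move=> [u0 [u1 [[[v0 u0K v0K] [v1 u1K v1K]] s0 s1 m0 m1]]].
(* Coordinates pull back along index maps, so the morphism from A to B uses the inverses v0 and
   v1. *)
pose re n m (u : 'I_n -> 'I_m) (x : 'cV[{mpoly rat[N]}]_m) : 'cV_n := \col_i x (u i) 0.
have relin n m u : linear (@re n m u : restr phi _ -> restr phi _).
  by move=> a x y; apply/matrixP => i j; rewrite !mxE.
have reM k l k' l' (D : 'M_(k, l)) (D' : 'M_(k', l')) (f : 'I_k -> 'I_k') (g : 'I_l -> 'I_l')
    f' g' x : cancel f' f -> cancel g g' -> cancel g' g ->
    (forall i j, D' (f i) (g j) = D i j) -> D' *m re _ _ g' x = re _ _ f' (D *m x).
  move=> fK gK gK' DD; apply/matrixP => i j; rewrite !mxE (reindex g) /=; last by exists g' => ? _.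
  by apply: eq_bigr => c _; rewrite mxE gK -{1}(fK i) DD.
have reMi k l k' l' (D : 'M_(k, l)) (D' : 'M_(k', l')) (f : 'I_k -> 'I_k') (g : 'I_l -> 'I_l')
    g' x : cancel g g' -> cancel g' g ->
    (forall i j, D' (f i) (g j) = D i j) -> D *m re _ _ g x = re _ _ f (D' *m x).
  move=> gK gK' DD; apply/matrixP => i j; rewrite !mxE [RHS](reindex g) /=; last by exists g' => ? _.
  by apply: eq_bigr => c _; rewrite mxE DD.
have f0g k v : gm_hom (g := mf0 (restr_mfact phi (mfact_of w A))) k v ->
  gm_hom (g := mf0 (restr_mfact phi (mfact_of w B))) k (re _ _ v0 v).
  by move=> hv i; rewrite mxE -{1}(v0K i) s0; apply: hv.
have f1g k v : gm_hom (g := mf1 (restr_mfact phi (mfact_of w A))) k v ->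
  gm_hom (g := mf1 (restr_mfact phi (mfact_of w B))) k (re _ _ v1 v).
  by move=> hv i; rewrite mxE -{1}(v1K i) s1; apply: hv.
have g0g k v : gm_hom (g := mf0 (restr_mfact phi (mfact_of w B))) k v ->
  gm_hom (g := mf0 (restr_mfact phi (mfact_of w A))) k (re _ _ u0 v).
  by move=> hv i; rewrite mxE -s0; apply: hv.
have g1g k v : gm_hom (g := mf1 (restr_mfact phi (mfact_of w B))) k v ->
  gm_hom (g := mf1 (restr_mfact phi (mfact_of w A))) k (re _ _ u1 v).
  by move=> hv i; rewrite mxE -s1; apply: hv.
unshelve eexists.
  apply: (@MFHom _ (restr_mfact phi (mfact_of w A)) (restr_mfact phi (mfact_of w B))
    (mklin (relin _ _ v0)) (mklin (relin _ _ v1)) f0g f1g) => v.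
    exact: (reM _ _ _ _ _ _ u1 u0).
  exact: (reM _ _ _ _ _ _ u0 u1).
unshelve eexists.
  apply: (@MFHom _ (restr_mfact phi (mfact_of w B)) (restr_mfact phi (mfact_of w A))
    (mklin (relin _ _ u0)) (mklin (relin _ _ u1)) g0g g1g) => v.
    exact: (reMi _ _ _ _ _ _ u1 u0 v0).
  exact: (reMi _ _ _ _ _ _ u0 u1 v1).
split; apply: homotopic_eq => v; apply/matrixP => i j; rewrite !mxE ?(u0K, u1K, v0K, v1K) ord1 //.
Qed.

End RestrictedMaps.

(** * Eliminating an internal variable *)

Section Elimination.
Variables (M N N' : nat).
Notation R := {mpoly rat[M]}.
Notation S := {mpoly rat[N]}.
Notation S' := {mpoly rat[N']}.
Variables (phi : {rmorphism R -> S}) (phi' : {rmorphism R -> S'}).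
Variables (iota : {rmorphism S' -> S}) (pi : {rmorphism S -> S'}) (b : S).
Hypothesis phi_iota : forall r, phi r = iota (phi' r).
Hypothesis iotaK : cancel iota pi.
Hypothesis b_neq0 : b != 0.
Hypothesis pi_b : pi b = 0.
Hypothesis decomp : forall p, exists c, p = iota (pi p) + b * c.

(** The quotient in the division by b with remainder in the image of [iota], unique since S is a
    domain. It is linear over the base ring but not over S; its failure to commute with the
    differentials of F is what the maps below have to correct. *)
Let theta p : S := epsilon (inhabits 0) (fun c => p = iota (pi p) + b * c).

Let thetaP p : p = iota (pi p) + b * theta p.
Proof. exact: epsilon_spec (decomp p). Qed.

Let theta_unique p c : p = iota (pi p) + b * c -> theta p = c.
Proof. by rewrite {1}(thetaP p) => /addrI/(mulfI b_neq0). Qed.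

Let thetaD p q : theta (p + q) = theta p + theta q.
Proof.
by apply: theta_unique; rewrite {1}(thetaP p) {1}(thetaP q) !rmorphD mulrDr addrACA.
Qed.

Let thetaZ r p : theta (phi r * p) = phi r * theta p.
Proof.
apply: theta_unique; rewrite {1}(thetaP p) mulrDr mulrCA rmorphM /=; congr (_ + _).
by rewrite !rmorphM /= phi_iota iotaK.
Qed.

Let theta_b p : theta (b * p) = p.
Proof. by apply: theta_unique; rewrite rmorphM /= pi_b mul0r rmorph0 add0r. Qed.

Let pi_phi r : pi (phi r) = phi' r.
Proof. by rewrite phi_iota iotaK. Qed.

Section Vectors.
Variables n : nat.
Implicit Types (v : 'cV[S]_n) (u : 'cV[S']_n).

Let T k (v : 'cV[S]_k) : 'cV[S]_k := map_mx theta v.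
Let P k l (v : 'M[S]_(k, l)) : 'M[S']_(k, l) := map_mx pi v.
Let I k (v : 'cV[S']_k) : 'cV[S]_k := map_mx iota v.

Lemma vec_decomp v : v = I (P v) + b *: T v.
Proof. by apply/matrixP => i j; rewrite !mxE -thetaP. Qed.

Lemma vec_theta_lin r v1 v2 : T (phi r *: v1 + v2) = phi r *: T v1 + T v2.
Proof. by apply/matrixP => i j; rewrite !mxE thetaD thetaZ. Qed.

Lemma vec_theta_b v : T (b *: v) = v.
Proof. by apply/matrixP => i j; rewrite !mxE theta_b. Qed.

Lemma vec_pi_lin r v1 v2 : P (phi r *: v1 + v2) = phi' r *: P v1 + P v2.
Proof. by apply/matrixP => i j; rewrite !mxE rmorphD rmorphM /= pi_phi. Qed.

Lemma vec_pi_b v : P (b *: v) = 0.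
Proof. by apply/matrixP => i j; rewrite !mxE rmorphM /= pi_b mul0r. Qed.

Lemma vec_iota_lin r u1 u2 : I (phi' r *: u1 + u2) = phi r *: I u1 + I u2.
Proof. by apply/matrixP => i j; rewrite !mxE rmorphD rmorphM /= phi_iota. Qed.

Lemma vec_iotaK u : P (I u) = u.
Proof. by apply/matrixP => i j; rewrite !mxE iotaK. Qed.

Lemma vec_thetaD v1 v2 : T (v1 + v2) = T v1 + T v2.
Proof. by apply/matrixP => i j; rewrite !mxE thetaD. Qed.

End Vectors.

Lemma vec_theta_mul k l (D : 'M[S]_(l, k)) (v : 'cV[S]_k) :
  map_mx theta (D *m v) = map_mx theta (D *m map_mx iota (map_mx pi v)) + D *m map_mx theta v.
Proof. by rewrite {1}[v]vec_decomp mulmxDr vec_thetaD -scalemxAr vec_theta_b. Qed.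

Variables (w : 'I_N -> nat) (w' : 'I_N' -> nat).
Hypothesis whomog_iota : forall k p, whomog w' k p -> whomog w k (iota p).
Hypothesis whomog_pi : forall k p, whomog w k p -> whomog w' k (pi p).
Variables (db h : int).
Hypothesis whomog_b : whomog w db b.

Let whomog_theta k p : whomog w k p -> whomog w (k - db) (theta p).
Proof.
move=> hp; refine (whomog_quo b_neq0 whomog_b _); rewrite subrK mulrC.
rewrite (_ : b * theta p = p - iota (pi p)); last by rewrite {2}(thetaP p) addrAC subrr add0r.
by apply: whomogB => //; apply/whomog_iota/whomog_pi.
Qed.

Variables (F : fmfact N) (a nu : S) (om : S').
Hypothesis homF : homog_mf w h F.
Hypothesis potF : has_pot F nu.
Hypothesis pot_ab : nu + a * b = iota om.

Let D0 := fmx0 F.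
Let D1 := fmx1 F.
Let X := restr_mfact phi (mfact_of w (cone F a b (db - h))).
Let Y := restr_mfact phi' (mfact_of w' (fmap pi F)).

Let T k (v : 'cV[S]_k) : 'cV[S]_k := map_mx theta v.
Let P k l (v : 'M[S]_(k, l)) : 'M[S']_(k, l) := map_mx pi v.
Let I k (v : 'cV[S']_k) : 'cV[S]_k := map_mx iota v.

Let D10 (v : 'cV_ _) : D1 *m (D0 *m v) = nu *: v.
Proof. by rewrite mulmxA potF.1 mul_scalar_mx. Qed.

Let D01 (v : 'cV_ _) : D0 *m (D1 *m v) = nu *: v.
Proof. by rewrite mulmxA potF.2 mul_scalar_mx. Qed.

Let P_potE (v : 'cV_ _) : P D1 *m (P D0 *m v) = om *: v.
Proof.
rewrite mulmxA -map_mxM potF.1 map_scalar_mx mul_scalar_mx; congr (_ *: _).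
by rewrite -[RHS]iotaK -pot_ab rmorphD rmorphM /= pi_b mulr0 addr0.
Qed.

Let P_potE' (v : 'cV_ _) : P D0 *m (P D1 *m v) = om *: v.
Proof.
rewrite mulmxA -map_mxM potF.2 map_scalar_mx mul_scalar_mx; congr (_ *: _).
by rewrite -[RHS]iotaK -pot_ab rmorphD rmorphM /= pi_b mulr0 addr0.
Qed.

(** [f_] keeps the first summand of the cone and sets b to 0. [g_] lifts by [iota]; the lift fails
    to commute with D by b theta (D v), which the second component cancels, with sign +1 or -1
    according to the sign of b in the differential. [h_] moves theta of the first summand into the
    second. *)
Let f_ k l (v : 'cV[S]_(k + l)) : 'cV[S']_k := P (usubmx v).

Let g_ k l (D : 'M[S]_(l, k)) (s : S) (v : 'cV[S']_k) : 'cV[S]_(k + l) :=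
  col_mx (I v) (s *: T (D *m I v)).

Let h_ k l (s : S) (v : 'cV[S]_(k + l)) : 'cV[S]_(l + k) := col_mx 0 (s *: T (usubmx v)).

Let f_lin k l : linear (@f_ k l : restr phi _ -> restr phi' _).
Proof. by apply: restr_linear => r u v; rewrite /f_ linearP; exact: vec_pi_lin. Qed.

Let g_lin k l D s : linear (@g_ k l D s : restr phi' _ -> restr phi _).
Proof.
apply: restr_linear => r u v; rewrite /g_ scale_col_mx add_col_mx -vec_iota_lin; congr col_mx.
rewrite /I vec_iota_lin mulmxDr -scalemxAr /T vec_theta_lin scalerDr !scalerA.
by rewrite [s * _]mulrC.
Qed.

Let h_lin k l s : linear (@h_ k l s : restr phi _ -> restr phi _).
Proof.
apply: restr_linear => r u v; rewrite /h_ scale_col_mx add_col_mx scaler0 addr0 linearP /=.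
by rewrite /T vec_theta_lin scalerDr !scalerA [s * _]mulrC.
Qed.

Let d0X (v : 'cV[S]_(_ + _)) : fmx0 (cone F a b (db - h)) *m v =
  col_mx (D0 *m usubmx v - b *: dsubmx v) (a *: usubmx v + D1 *m dsubmx v).
Proof. by rewrite -{1}[v]vsubmxK /= mul_block_col mulNmx !mul_scalar_mx. Qed.

Let d1X (v : 'cV[S]_(_ + _)) : fmx1 (cone F a b (db - h)) *m v =
  col_mx (D1 *m usubmx v + b *: dsubmx v) (- (a *: usubmx v) + D0 *m dsubmx v).
Proof. by rewrite -{1}[v]vsubmxK /= mul_block_col mulNmx !mul_scalar_mx. Qed.

(* b theta (D v) is the part of D v that a lift of v to S fails to lift. *)
Let lift_D k l (D : 'M[S]_(l, k)) v : b *: T (D *m I v) = D *m I v - I (P D *m v).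
Proof.
rewrite [in RHS](vec_decomp (D *m I v)) addrAC.
by rewrite [map_mx pi (D *m _)]map_mxM [map_mx pi (I v)]vec_iotaK subrr add0r.
Qed.

(** f g is the identity on the nose. In g f - 1 the first component is - b theta v, which the entry
    b of the differential produces from [h_]; the second is settled by theta (b v) = v and the
    product formula [vec_theta_mul]. *)
Lemma cone_heq : heq X Y.
Proof.
have f0g k v : gm_hom (g := mf0 X) k v -> gm_hom (g := mf0 Y) k (f_ v).
  move=> hv i; rewrite !mxE; apply: whomog_pi; have := hv (lshift _ i).
  by rewrite /= cat2l.
have f1g k v : gm_hom (g := mf1 X) k v -> gm_hom (g := mf1 Y) k (f_ v).
  move=> hv i; rewrite !mxE; apply: whomog_pi; have := hv (lshift _ i).
  by rewrite /= cat2l.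
have g0g k v : gm_hom (g := mf0 Y) k v -> gm_hom (g := mf0 X) k (g_ D0 1 v).
  move=> hv; apply: cat2P => i; rewrite /= ?cat2l ?cat2r ?col_mxEu ?col_mxEd.
    by rewrite mxE; apply/whomog_iota/hv.
  rewrite !mxE mul1r (_ : k - _ = (k + h - fsh1 i) - db); last by ring.
  apply/whomog_theta/whomog_sum => j _; rewrite mxE.
  rewrite (_ : k + h - _ = (h + fsh0 j - fsh1 i) + (k - fsh0 j)); last by ring.
  by apply: whomogM; [apply: homF.1 | apply/whomog_iota/hv].
have g1g k v : gm_hom (g := mf1 Y) k v -> gm_hom (g := mf1 X) k (g_ D1 (-1) v).
  move=> hv; apply: cat2P => i; rewrite /= ?cat2l ?cat2r ?col_mxEu ?col_mxEd.
    by rewrite mxE; apply/whomog_iota/hv.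
  rewrite !mxE mulN1r (_ : k - _ = (k + h - fsh0 i) - db); last by ring.
  apply/whomogN/whomog_theta/whomog_sum => j _; rewrite mxE.
  rewrite (_ : k + h - _ = (h + fsh1 j - fsh0 i) + (k - fsh1 j)); last by ring.
  by apply: whomogM; [apply: homF.2 | apply/whomog_iota/hv].
have fd0 v : mfd0 Y (f_ v) = f_ (mfd0 X v).
  rewrite /f_ -[mfd0 X v]/(fmx0 (cone F a b (db - h)) *m (v : 'cV_ _)) d0X col_mxKu.
  by rewrite /P map_mxB map_mxM [map_mx pi (b *: _)]vec_pi_b subr0.
have fd1 v : mfd1 Y (f_ v) = f_ (mfd1 X v).
  rewrite /f_ -[mfd1 X v]/(fmx1 (cone F a b (db - h)) *m (v : 'cV_ _)) d1X col_mxKu.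
  by rewrite /P map_mxD map_mxM [map_mx pi (b *: _)]vec_pi_b addr0.
(* Second components are compared after multiplication by b: [lift_D] then removes theta, and the
   identity becomes nu + a b = iota om. *)
have binj k (v v' : 'cV[S]_k) : b *: v = b *: v' -> v = v'.
  by move=> e; rewrite -[v]vec_theta_b e vec_theta_b.
have gd0 v : mfd0 X (g_ D0 1 v) = g_ D1 (-1) (mfd0 Y v).
  rewrite -[LHS]/(fmx0 (cone F a b (db - h)) *m (g_ D0 1 v : 'cV_ _)) d0X.
  rewrite /g_ col_mxKu col_mxKd !scale1r lift_D opprB addrC subrK.
  congr col_mx; apply: binj; rewrite scaleN1r scalerN lift_D scalerDr.
  rewrite scalemxAr lift_D mulmxBr D10 opprB P_potE scalerA [b * a]mulrC.
  rewrite -[I (om *: v)]/(map_mx iota (om *: v)) map_mxZ -pot_ab scalerDl.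
  by rewrite addrA [X in X - _]addrC.
have gd1 v : mfd1 X (g_ D1 (-1) v) = g_ D0 1 (mfd1 Y v).
  rewrite -[LHS]/(fmx1 (cone F a b (db - h)) *m (g_ D1 (-1) v : 'cV_ _)) d1X.
  rewrite /g_ col_mxKu col_mxKd !scale1r !scaleN1r scalerN lift_D opprB addrC subrK.
  congr col_mx; apply: binj; rewrite lift_D scalerDr mulmxN !scalerN.
  rewrite scalemxAr lift_D mulmxBr D01 opprB P_potE' scalerA [b * a]mulrC.
  rewrite -[I (om *: v)]/(map_mx iota (om *: v)) map_mxZ -pot_ab scalerDl.
  by rewrite addrC -addrA -opprD.
pose fm := @MFHom _ X Y (mklin (@f_lin _ _)) (mklin (@f_lin _ _)) f0g f1g fd0 fd1.
pose gm := @MFHom _ Y X (mklin (@g_lin _ _ D0 1)) (mklin (@g_lin _ _ D1 (-1))) g0g g1g gd0 gd1.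
exists fm, gm; split; last first.
  by apply: homotopic_eq => v; rewrite /= /f_ /g_ col_mxKu; apply: vec_iotaK.
exists (mklin (@h_lin _ _ (-1))), (mklin (@h_lin _ _ 1)); split=> v.
  rewrite -[LHS]/(g_ D0 1 (f_ v) - v).
  rewrite -[RHS]/(h_ 1 (fmx0 (cone F a b (db - h)) *m (v : 'cV_ _))
    + fmx1 (cone F a b (db - h)) *m (h_ (-1) v : 'cV_ _)).
  rewrite d0X d1X /h_ /g_ /f_ !col_mxKu !col_mxKd !scale1r !scaleN1r mulmx0 scaler0 oppr0 !add0r.
  rewrite add_col_mx add0r -{3}[v]vsubmxK opp_col_mx add_col_mx; congr col_mx.
    by rewrite {2}[usubmx v]vec_decomp opprD addrA subrr add0r scalerN.
  by rewrite /T /P /I -scalerN vec_thetaD vec_theta_b [in RHS]vec_theta_mul mulmxN [RHS]addrAC addrK.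
rewrite -[LHS]/(g_ D1 (-1) (f_ v) - v).
rewrite -[RHS]/(h_ (-1) (fmx1 (cone F a b (db - h)) *m (v : 'cV_ _))
  + fmx0 (cone F a b (db - h)) *m (h_ 1 v : 'cV_ _)).
rewrite d0X d1X /h_ /g_ /f_ !col_mxKu !col_mxKd !scale1r !scaleN1r mulmx0 scaler0 !add0r.
rewrite add_col_mx add0r -{3}[v]vsubmxK opp_col_mx add_col_mx; congr col_mx.
  by rewrite {2}[usubmx v]vec_decomp opprD addrA subrr add0r.
by rewrite /T /P /I vec_thetaD vec_theta_b [in RHS]vec_theta_mul !opprD [RHS]addrAC subrK.
Qed.


End Elimination.

(** * Eliminating all internal variables *)

Lemma big_ord_foldr (T : Type) (op : T -> T -> T) (x : T) r (F : 'I_r -> T) :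
  \big[op/x]_(j < r) F j = foldr op x [seq F j | j <- enum 'I_r].
Proof.
rewrite enumT; set s := Finite.enum _; rewrite [LHS](_ : _ = \big[op/x]_(j <- s) F j).
  by elim: s => [|j s IH]; rewrite (big_nil, big_cons) //= IH.
by rewrite /s -/(index_enum _) /index_enum; case: index_enum_key.
Qed.

Section Foldl.
Variable N : nat.
Implicit Types (P : fmfact N) (Ks : seq (fmfact N)).

(** The iterated products of the vertices nest to the right; nesting to the left makes the last row
    the right factor, as [ftens_row] requires. *)
Lemma heq_foldl M (phi : {rmorphism {mpoly rat[M]} -> {mpoly rat[N]}}) (w : 'I_N -> nat) Ks P :
  heq (restr_mfact phi (mfact_of w (ftens P (foldr (@ftens N) (funit N) Ks))))
      (restr_mfact phi (mfact_of w (foldl (@ftens N) P Ks))).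
Proof.
elim: Ks P => [|K Ks IH] P /=; first exact/heq_sym/fiso_heq/ftens_funit.
exact: heq_trans (fiso_heq _ _ (ftensA _ _ _)) (IH _).
Qed.

Lemma homog_foldl (w : 'I_N -> nat) h (I : Type) (s : seq I) (K : I -> fmfact N) P :
  homog_mf w h P -> (forall i, homog_mf w h (K i)) ->
  homog_mf w h (foldl (@ftens N) P [seq K i | i <- s]).
Proof.
by move=> hP hK; elim: s P hP => [|i s IH] P hP //=; apply/IH/homog_ftens.
Qed.

Lemma foldl_pot (I : Type) (s : seq I) (K : I -> fmfact N) (om : I -> {mpoly rat[N]}) P rho :
  has_pot P rho -> (forall i, has_pot (K i) (om i)) ->
  has_pot (foldl (@ftens N) P [seq K i | i <- s]) (rho + \sum_(i <- s) om i).
Proof.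
move=> hP hK; elim: s P rho hP => [|i s IH] P rho hP; first by rewrite big_nil addr0.
by rewrite big_cons addrA; apply/IH/ftens_pot.
Qed.

Lemma foldr_pot (I : Type) (s : seq I) (K : I -> fmfact N) (om : I -> {mpoly rat[N]}) :
  (forall i, has_pot (K i) (om i)) ->
  has_pot (foldr (@ftens N) (funit N) [seq K i | i <- s]) (\sum_(i <- s) om i).
Proof.
move=> hK; elim: s => [|i s IH]; first by rewrite big_nil; apply: funit_pot.
by rewrite big_cons; apply: ftens_pot.
Qed.

Lemma homog_foldr (w : 'I_N -> nat) h (I : Type) (s : seq I) (K : I -> fmfact N) :
  (forall i, homog_mf w h (K i)) ->
  homog_mf w h (foldr (@ftens N) (funit N) [seq K i | i <- s]).
Proof.
by move=> hK; elim: s => [|i s IH]; [apply: homog_funit | apply: homog_ftens].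
Qed.

End Foldl.

Section FmapFold.
Variables (a b : nat) (f : {rmorphism {mpoly rat[a]} -> {mpoly rat[b]}}).

Lemma fmap_foldl P Ks : fmap f (foldl (@ftens a) P Ks) = foldl (@ftens b) (fmap f P) (map (fmap f) Ks).
Proof. by elim: Ks P => [|K Ks IH] P //=; rewrite IH fmap_ftens. Qed.

Lemma fmap_foldr Ks :
  fmap f (foldr (@ftens a) (funit a) Ks) = foldr (@ftens b) (funit b) (map (fmap f) Ks).
Proof. by elim: Ks => [|K Ks IH] /=; rewrite ?fmap_funit // fmap_ftens IH. Qed.

End FmapFold.

Lemma eq_fmap a b (f g : {mpoly rat[a]} -> {mpoly rat[b]}) M : f =1 g -> fmap f M = fmap g M.
Proof. by move=> fg; rewrite /fmap !(eq_map_mx _ fg). Qed.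

Lemma fmap_comp a b c (f : {mpoly rat[b]} -> {mpoly rat[c]}) (g : {mpoly rat[a]} -> {mpoly rat[b]}) M :
  fmap f (fmap g M) = fmap (f \o g) M.
Proof. by rewrite /fmap /= -!map_mx_comp. Qed.

Lemma fmap_id a (M : fmfact a) : fmap id M = M.
Proof. by case: M => *; rewrite /fmap /= !map_mx_id. Qed.

(** * Removing the internal variables from the last to the first *)

Section Tower.
Variables (N : nat) (w : 'I_N -> nat).

(** The target is a ring in N + 0 variables, so that the last stage of the induction has the same
    form as the others. *)
Definition evalX k (e : 'I_k -> {mpoly rat[N]}) : {mpoly rat[N + k]} -> {mpoly rat[N + 0]} :=
  sub (cat2 (fun i => 'X_(lshift 0 i)) (fun j => rename (lshift 0) (e j))).

HB.instance Definition _ k (e : 'I_k -> {mpoly rat[N]}) := GRing.RMorphism.copy (evalX e)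
  (sub (cat2 (fun i => 'X_(lshift 0 i)) (fun j => rename (lshift 0) (e j)))).

Definition lin_row k (c : bool) (e : 'I_k -> {mpoly rat[N]}) (j : 'I_k) : {mpoly rat[N + k]} :=
  (-1) ^+ c * ('X_(rshift N j) - rename (lshift k) (e j)).

Section Step.
Variables (k : nat) (e : 'I_k.+1 -> {mpoly rat[N]}).

Let wid (j : 'I_k) : 'I_k.+1 := widen_ord (leqnSn k) j.

Definition tow_in : {mpoly rat[N + k]} -> {mpoly rat[N + k.+1]} :=
  rename (cat2 (lshift k.+1) (fun j => rshift N (wid j))).

(** [insub] fails exactly at the last internal variable, which is replaced by its external value;
    the others are kept. *)
Definition tow_img : 'I_(N + k.+1) -> {mpoly rat[N + k]} :=
  cat2 (fun i => 'X_(lshift k i))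
    (fun j => if insub (nat_of_ord j) is Some j' then 'X_(rshift N (j' : 'I_k))
              else rename (lshift k) (e ord_max)).

Definition tow_out := sub tow_img.

HB.instance Definition _ := GRing.RMorphism.copy tow_out (sub tow_img).

Lemma tow_img_wid j : tow_img (rshift N (wid j)) = 'X_(rshift N j).
Proof. by rewrite /tow_img cat2r /= -[nat_of_ord j]/(val j) valK. Qed.

Lemma tow_img_max : tow_img (rshift N ord_max) = rename (lshift k) (e ord_max).
Proof. by rewrite /tow_img cat2r /= insubF // ltnn. Qed.

Lemma tow_img_l i : tow_img (lshift k.+1 i) = 'X_(lshift k i).
Proof. by rewrite /tow_img cat2l. Qed.

Lemma tow_outX i : tow_out 'X_i = tow_img i.
Proof. exact: subX. Qed.

Lemma tow_out_base p : tow_out (rename (lshift k.+1) p) = rename (lshift k) p.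
Proof. by rewrite /tow_out sub_rename; apply: eq_sub => i; apply: tow_img_l. Qed.

Lemma tow_in_base p : tow_in (rename (lshift k) p) = rename (lshift k.+1) p.
Proof. by rewrite /tow_in [LHS]renameE sub_rename; apply: eq_sub => i /=; rewrite cat2l. Qed.

Lemma tow_inK p : tow_out (tow_in p) = p.
Proof.
rewrite /tow_out /tow_in sub_rename; apply: sub_id.
by apply: cat2P => i /=; rewrite ?cat2l ?cat2r ?tow_img_l ?tow_img_wid.
Qed.

Lemma tow_out_row_max c : tow_out (lin_row c e ord_max) = 0.
Proof.
by rewrite /lin_row /tow_out rmorphM rmorphB /= -/tow_out tow_outX tow_out_base tow_img_max subrr mulr0.
Qed.

Lemma tow_out_row c j : tow_out (lin_row c e (wid j)) = lin_row c (e \o wid) j.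
Proof.
rewrite /lin_row /tow_out rmorphM rmorphB rmorphXn rmorphN1 /= -/tow_out tow_outX tow_out_base.
by rewrite tow_img_wid.
Qed.

Lemma ord_wid_max (P : 'I_k.+1 -> Prop) : (forall j, P (wid j)) -> P ord_max -> forall j, P j.
Proof.
move=> hw hm j; have [jk|kj] := ltnP j k.
  by have -> : j = wid (Ordinal jk) by apply: val_inj.
by have -> : j = ord_max by apply/val_inj/eqP; rewrite eqn_leq kj -ltnS ltn_ord.
Qed.

(** The identity and the substitution x := e agree on all variables but the last, where they differ
    by a sign times the row; [sub_dvd] extends this to all polynomials. *)
Lemma tow_decomp c p : exists d, p = tow_in (tow_out p) + lin_row c e ord_max * d.
Proof.
have [] := @sub_dvd _ _ (fun i => 'X_i) (fun i => tow_in (tow_img i)) (lin_row c e ord_max) _ p.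
  apply: cat2P => i; first by exists 0; rewrite tow_img_l /tow_in renameX cat2l mul0r subrr.
  elim/ord_wid_max: i => [j|].
    by exists 0; rewrite tow_img_wid /tow_in renameX cat2r mul0r subrr.
  exists ((-1) ^+ c); rewrite tow_img_max tow_in_base /lin_row mulrA -exprD.
  by rewrite -signr_odd oddD addbb mul1r.
move=> d; rewrite sub_id // => hd; exists d.
have -> : tow_in (tow_out p) = sub (fun i => tow_in (tow_img i)) p by exact: rename_sub.
by rewrite mulrC hd addrC subrK.
Qed.

Lemma evalX_tow p : evalX (e \o wid) (tow_out p) = evalX e p.
Proof.
rewrite /evalX /tow_out sub_sub; apply: eq_sub; apply: cat2P => i.
  by rewrite tow_img_l subX !cat2l.
elim/ord_wid_max: i => [j|]; first by rewrite tow_img_wid subX !cat2r.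
by rewrite tow_img_max sub_rename !cat2r; apply: eq_sub => i /=; rewrite cat2l.
Qed.

Section Weights.
Variables (wx : 'I_k.+1 -> nat).
Hypothesis whomog_e : forall j, whomog w (wx j)%:Z (e j).

Lemma whomog_base l (wl : 'I_l -> nat) d p :
  whomog w d p -> whomog (cat2 w wl) d (rename (lshift l) p).
Proof. by apply: whomog_rename => i; rewrite cat2l. Qed.

Lemma whomog_tow_in d p : whomog (cat2 w (wx \o wid)) d p -> whomog (cat2 w wx) d (tow_in p).
Proof. by apply: whomog_rename; apply: cat2P => i; rewrite ?cat2l ?cat2r ?cat2l ?cat2r. Qed.

Lemma whomog_tow_out d p : whomog (cat2 w wx) d p -> whomog (cat2 w (wx \o wid)) d (tow_out p).
Proof.
apply: whomog_sub; apply: cat2P => i.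
  by rewrite tow_img_l cat2l; have := @whomogX _ (cat2 w (wx \o wid)) (lshift k i); rewrite cat2l.
rewrite cat2r; elim/ord_wid_max: i => [j|].
  by rewrite tow_img_wid; have := @whomogX _ (cat2 w (wx \o wid)) (rshift N j); rewrite cat2r.
by rewrite tow_img_max; apply: whomog_base.
Qed.

End Weights.

End Step.

Lemma whomog_lin_row k (wx : 'I_k -> nat) c (e : 'I_k -> {mpoly rat[N]}) j :
  whomog w (wx j)%:Z (e j) -> whomog (cat2 w wx) (wx j)%:Z (lin_row c e j).
Proof.
move=> he; rewrite /lin_row -[_%:Z]add0r; apply: whomogM.
  by case: c; [apply/whomogN/whomog1 | apply: whomog1].
apply: whomogB; last by apply: whomog_rename he => i; rewrite cat2l.
by have := @whomogX _ (cat2 w wx) (rshift N j); rewrite cat2r.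
Qed.

Lemma lin_row_neq0 k c (e : 'I_k -> {mpoly rat[N]}) j : lin_row c e j != 0.
Proof.
rewrite /lin_row mulf_eq0 signr_eq0 /=; apply/eqP.
pose z (i : 'I_N) : {mpoly rat[0]} := 0.
move/(congr1 (sub (cat2 z (fun j => 1 + sub z (e j))))).
rewrite rmorphB rmorph0 /= subX sub_rename cat2r.
rewrite (@eq_sub _ _ (_ \o _) z) => [|i /=]; last by rewrite cat2l.
by rewrite addrK => /eqP; rewrite oner_eq0.
Qed.

Definition w0 : 'I_(N + 0) -> nat := cat2 w (fun=> 0%N).

(** Induction on k, removing the last row with [cone_heq]. As the e_j are external, this turns the
    remaining second entries into rows of the same linear form. The first entries change by the
    substitution, so they are arbitrary homogeneous polynomials here, constrained only by the total
    potential being external. *)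
Lemma eliminate k (wx : 'I_k -> nat) (e : 'I_k -> {mpoly rat[N]}) (c : bool) h
    (a : 'I_k -> {mpoly rat[N + k]}) (P : fmfact (N + k)) rho om :
  (forall j, whomog w (wx j)%:Z (e j)) ->
  homog_mf (cat2 w wx) h P ->
  (forall j, whomog (cat2 w wx) (h + h - (wx j)%:Z) (a j)) ->
  has_pot P rho ->
  rho + \sum_j a j * lin_row c e j = rename (lshift k) om ->
  heq (restr_mfact (rename (lshift k)) (mfact_of (cat2 w wx)
         (foldl (@ftens _) P [seq krow (a j) (lin_row c e j) ((wx j)%:Z - h) | j <- enum 'I_k])))
      (restr_mfact (rename (lshift 0)) (mfact_of w0 (fmap (evalX e) P))).
Proof.
elim: k => [|k IH] in wx e a P rho *.
  move=> _ _ _ _ _; rewrite (_ : enum 'I_0 = [::]); last by apply/size0nil; rewrite size_enum_ord.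
  rewrite (_ : cat2 w wx = w0); last first.
    by apply: functional_extensionality; apply: cat2P => [i|[]//]; rewrite /w0 !cat2l.
  rewrite (@eq_fmap _ _ _ id) ?fmap_id => [|p]; last first.
    by apply: sub_id; apply: cat2P => [i|[]//]; rewrite cat2l.
  exists (mf_id _), (mf_id _); split; exact: homotopic_eq.
move=> he hP ha potP pot; rewrite enum_ordSr map_rcons foldl_rcons -map_comp.
set F := foldl _ _ _; pose wid (j : 'I_k) : 'I_k.+1 := widen_ord (leqnSn k) j.
have hrow j : homog_mf (cat2 w wx) h (krow (a j) (lin_row c e j) ((wx j)%:Z - h)).
  apply: homog_krow; first by have := ha j; congr (whomog _ _ _); ring.
  by have := @whomog_lin_row _ wx c e j (he j); congr (whomog _ _ _); ring.
have homF : homog_mf (cat2 w wx) h F by apply: homog_foldl => // j; apply: hrow.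
have potF : has_pot F (rho + \sum_(j < k) a (wid j) * lin_row c e (wid j)).
  rewrite -big_enum /=; apply: foldl_pot => // j; exact: krow_pot.
have base r : rename (lshift k.+1) r = @tow_in k (rename (lshift k) r).
  by rewrite tow_in_base.
have pot' : rho + \sum_(j < k) a (wid j) * lin_row c e (wid j) + a ord_max * lin_row c e ord_max
   = @tow_in k (rename (lshift k) om).
  by rewrite -base -pot big_ord_recr addrA.
apply: heq_trans (fiso_heq _ _ (ftens_row _ _ _ _)) _.
apply: heq_trans (cone_heq base (@tow_inK k e) (lin_row_neq0 c e ord_max) (tow_out_row_max e c)
  (tow_decomp e c) (@whomog_tow_in _ wx) (whomog_tow_out he)
  (@whomog_lin_row _ wx c e ord_max (he ord_max)) homF potF pot') _.
rewrite /F fmap_foldl -map_comp.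
rewrite (_ : [seq _ | j <- _] = [seq krow (tow_out e (a (wid j))) (lin_row c (e \o wid) j)
  ((wx (wid j))%:Z - h) | j <- enum 'I_k]); last first.
  by apply: eq_map => j /=; rewrite fmap_krow; congr krow; exact: tow_out_row.
have -> : fmap (evalX e) P = fmap (evalX (e \o wid)) (fmap (tow_out e) P).
  by rewrite fmap_comp; apply: eq_fmap => p; rewrite /= evalX_tow.
apply: (IH (wx \o wid) (e \o wid) _ (fmap (tow_out e) P) (tow_out e rho)).
- by move=> j; apply: he.
- by apply: homog_fmap hP; apply: whomog_tow_out.
- by move=> j; apply: (whomog_tow_out he); apply: ha.
- exact: fmap_pot.
- rewrite -(tow_out_base e) -pot rmorphD big_ord_recr /= rmorphD rmorphM /=.
  rewrite tow_out_row_max mulr0 addr0 rmorph_sum; congr (_ + _); apply: eq_bigr => j _.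
  by rewrite rmorphM /= tow_out_row.
Qed.

End Tower.

(** * Freeness over the subring of the external variables *)

Lemma inj_surj_bij (A B : Type) (f : A -> B) :
  injective f -> (forall y, exists x, f x = y) -> bijective f.
Proof.
move=> fi fs; pose g y := proj1_sig (constructive_indefinite_description _ (fs y)).
have gK : cancel g f by move=> y; exact: proj2_sig (constructive_indefinite_description _ (fs y)).
by exists g => // x; apply: fi; rewrite gK.
Qed.

Section JoinMonomials.
Variables N k : nat.

Definition mjoin (m1 : 'X_{1..N}) (m2 : 'X_{1..k}) : 'X_{1..N + k} :=
  [multinom cat2 (fun i => m1 i) (fun j => m2 j) i | i < N + k].
Definition mleft (m : 'X_{1..N + k}) : 'X_{1..N} := [multinom m (lshift k i) | i < N].
Definition mright (m : 'X_{1..N + k}) : 'X_{1..k} := [multinom m (rshift N j) | j < k].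

Lemma mjoinK m : mjoin (mleft m) (mright m) = m.
Proof.
by apply/mnmP; apply: cat2P => i; rewrite mnmE ?cat2l ?cat2r mnmE.
Qed.

Lemma mleft_join m1 m2 : mleft (mjoin m1 m2) = m1.
Proof. by apply/mnmP => i; rewrite !mnmE cat2l. Qed.

Lemma mright_join m1 m2 : mright (mjoin m1 m2) = m2.
Proof. by apply/mnmP => i; rewrite !mnmE cat2r. Qed.

Lemma mjoin_eq m1 m2 m1' m2' :
  (mjoin m1 m2 == mjoin m1' m2') = (m1 == m1') && (m2 == m2').
Proof.
apply/eqP/andP => [e|[/eqP -> /eqP ->] //].
by split; apply/eqP; [rewrite -(mleft_join m1 m2) e mleft_join | rewrite -(mright_join m1 m2) e mright_join].
Qed.

Lemma mjoinD m1 m2 : (mjoin m1 0%MM + mjoin 0%MM m2)%MM = mjoin m1 m2.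
Proof.
by apply/mnmP; apply: cat2P => i; rewrite mnmDE !mnmE ?cat2l ?cat2r ?mnm0E ?addn0 ?add0n.
Qed.

Lemma wt_mjoin (w : 'I_N -> nat) (wx : 'I_k -> nat) m1 m2 :
  wt (cat2 w wx) (mjoin m1 m2) = (wt w m1 + wt wx m2)%N.
Proof.
rewrite /wt big_split_ord /=; congr (_ + _)%N; apply: eq_bigr => i _.
  by rewrite mnmE !cat2l.
by rewrite mnmE !cat2r.
Qed.

Lemma rename_lshiftXm m : rename (lshift k) 'X_[m] = 'X_[mjoin m 0%MM] :> {mpoly rat[N + k]}.
Proof.
rewrite renameE subXm (mpolyXE_id rat (mjoin m 0%MM)) big_split_ord /= [X in _ * X]big1 ?mulr1 => [|j _].
  by apply: eq_bigr => i _; rewrite mnmE cat2l.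
by rewrite mnmE cat2r mnmE expr0.
Qed.

Lemma mcoeff_rename_join q m m1 m2 :
  (rename (lshift k) q * 'X_[mjoin 0%MM m])@_(mjoin m1 m2) = q@_m1 * (m == m2)%:R.
Proof.
elim/mpolyind: q => [|c m' p _ _ IH]; first by rewrite rmorph0 mul0r !mcoeff0 mul0r.
rewrite rmorphD /= mulrDl !mcoeffD IH mulrDl; congr (_ + _).
have -> : rename (lshift k) (c *: 'X_[m']) = c *: 'X_[mjoin m' 0%MM] :> {mpoly rat[N + k]}.
  by rewrite renameE linearZ /= -renameE rename_lshiftXm.
rewrite -scalerAl -mpolyXD mjoinD !mcoeffZ !mcoeffX mjoin_eq.
by rewrite -mulnb natrM mulrA.
Qed.

Variables (w : 'I_N -> nat) (wx : 'I_k -> nat) (r : nat) (sh : 'I_r -> int).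

(** A basis is given by the products of a standard vector and a monomial in the internal variables,
    whose weight adds to the shift. *)
Lemma free_graded_restr :
  free_graded w (restr_gmod (rename (lshift k)) (free_gmod (cat2 w wx) sh)).
Proof.
pose I : choiceType := ('I_r * 'X_{1..k})%type.
pose d (z : I) : int := sh z.1 + (wt wx z.2)%:Z.
pose b (z : I) : 'cV[{mpoly rat[N + k]}]_r := 'X_[mjoin 0%MM z.2] *: delta_mx z.1 0.
exists I, d, b => comb.
have coefE c i m1 m2 : ((comb c : 'cV[{mpoly rat[N + k]}]_r) i 0)@_(mjoin m1 m2) = (c (i, m2))@_m1.
  rewrite /comb [X in fun_of_matrix X](_ : _ = (\sum_(z <- finsupp c)
    rename (lshift k) (c z) *: b z : 'cV[{mpoly rat[N + k]}]_r)) //.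
  rewrite summxE raddf_sum /= (eq_bigr (fun z => (c z)@_m1 * (z == (i, m2))%:R)); last first.
    move=> [j m] _; rewrite !mxE /= eqxx andbT mulrA xpair_eqE [j == i]eq_sym.
    case: (i == j) => /=; first by rewrite mulr1 mcoeff_rename_join.
    by rewrite !mulr0 mcoeff0.
  have [cz|cz] := boolP ((i, m2) \in finsupp c).
    rewrite (bigD1_seq (i, m2)) ?fset_uniq //= eqxx mulr1 big1 ?addr0 // => z /negbTE ->.
    by rewrite mulr0.
  rewrite fsfun_dflt // mcoeff0 big1_seq // => z /andP[_ zc]; case: eqP => [zE|_].
    by rewrite -zE zc in cz.
  by rewrite mulr0.
split; last first.
  move=> n c; split=> [hc [i m2] m mc|hc i m].
    have := hc i (mjoin m m2); rewrite mcoeff_msupp coefE -mcoeff_msupp => /(_ mc).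
    by rewrite wt_mjoin PoszD /d /= => e; apply: (addIr (wt wx m2)%:Z); rewrite e; ring.
  rewrite mcoeff_msupp -(mjoinK m) coefE -mcoeff_msupp => /(hc (i, mright m)).
  by rewrite wt_mjoin PoszD /d /= => ->; ring.
apply: inj_surj_bij => [c c' cc'|v].
  by apply/fsfunP => -[i m2]; apply/mpolyP => m1; rewrite -!coefE cc'.
(* The coordinate of v at z collects the terms of entry z.1 with internal part z.2; [s] lists the
   finitely many z that can occur. *)
pose F (z : I) : {mpoly rat[N]} := \sum_(m <- msupp ((v : 'cV_r) z.1 0) | mright m == z.2)
  ((v : 'cV_r) z.1 0)@_m *: 'X_[mleft m].
pose s : seq I := [seq (i, mright m) | i <- enum 'I_r, m <- msupp ((v : 'cV_r) i 0)].
pose c : {fsfun I -> {mpoly rat[N]} with 0} := [fsfun z in [fset z in s]%fset => F z].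
exists c; apply/matrixP => i j; rewrite ord1; apply/mpolyP => m; rewrite -(mjoinK m) coefE.
have FE : (F (i, mright m))@_(mleft m) = ((v : 'cV_r) i 0)@_m.
  rewrite /F raddf_sum /= (eq_bigr (fun m' => ((v : 'cV_r) i 0)@_m' * (m' == m)%:R)); last first.
    move=> m' /eqP e; rewrite mcoeffZ mcoeffX; congr (_ * _%:R).
    by rewrite -{2}(mjoinK m) -{2}(mjoinK m') mjoin_eq e eqxx andbT.
  have [mv|mv] := boolP (m \in msupp ((v : 'cV_r) i 0)).
    rewrite big_mkcond (bigD1_seq m) ?msupp_uniq //= !eqxx mulr1 big1 ?addr0 // => m' /negbTE ->.
    by rewrite mulr0 if_same.
  rewrite memN_msupp_eq0 // big1_seq // => m' /andP[_ m'v]; case: eqP => [e|_].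
    by rewrite -e m'v in mv.
  by rewrite mulr0.
rewrite /c fsfunE; case: ifP => [_|]; first by rewrite FE mjoinK.
move/negbT => ns; rewrite mcoeff0 mjoinK; apply/esym/memN_msupp_eq0.
apply: contra ns => mv; rewrite !inE; apply/allpairsPdep; exists i, m.
by rewrite mem_enum.
Qed.

End JoinMonomials.

(** * Contracting the internal edge of a tree *)

Lemma quo_unique N (p q c : {mpoly rat[N]}) : q != 0 -> c * q = p -> quo p q = c.
Proof. by move=> q0 cq; apply: (mulIf q0); rewrite cq; apply: quoP; exists c. Qed.

Lemma rename_rename a b c (s : 'I_b -> 'I_c) (t : 'I_a -> 'I_b) p :
  rename s (rename t p) = rename (s \o t) p.
Proof. by rewrite [LHS]renameE sub_rename. Qed.

Lemma restr_is_mfact N k (w : 'I_N -> nat) (wx : 'I_k -> nat) (F : fmfact (N + k)) d om :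
  has_pot F (rename (lshift k) om) -> whomog w d om ->
  is_mfact w om (restr_mfact (rename (lshift k)) (mfact_of (cat2 w wx) F)).
Proof.
move=> [h10 h01] hom; split; [exact: free_graded_restr | exact: free_graded_restr | by exists d | |].
  move=> v; change (fmx1 F *m (fmx0 F *m v) = rename (lshift k) om *: (v : 'cV_ _)).
  by rewrite mulmxA h10 mul_scalar_mx.
move=> v; change (fmx0 F *m (fmx1 F *m v) = rename (lshift k) om *: (v : 'cV_ _)).
by rewrite mulmxA h01 mul_scalar_mx.
Qed.

(** Both kinds of vertex at once: [m] is 0 for merging and -pq for splitting. *)
Definition vert (c : bool) (m : int) n p q r : fmfact (p + q + r) :=
  fshift m (\big[@ftens _/funit _]_(j < r) vrow n (vu c) (vv c) j).

Section Vertex.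
Variables (n p q r : nat).
Hypothesis r_def : r = (p + q)%N.
Hypothesis p_gt0 : (0 < p)%N.
Hypothesis r_le : (r <= n)%N.

Lemma vrowE c (j : 'I_r) : vrow n (@vu p q r c) (@vv p q r c) j =
  krow (va n c j) (vb c j) ((2 * j.+1)%N%:Z - n.+1%:Z).
Proof.
by rewrite /vrow /koszul -(@vrow_shift n p q r r_def p_gt0 r_le c j).
Qed.

Lemma vertE c m : vert c m n p q r = fshift m (foldr (@ftens _) (funit _)
  [seq krow (@va n p q r c j) (vb c j) ((2 * j.+1)%N%:Z - n.+1%:Z) | j <- enum 'I_r]).
Proof.
by rewrite /vert big_ord_foldr; congr (fshift _ (foldr _ _ _)); apply: eq_map => j; apply: vrowE.
Qed.

Lemma vert_pot c m : has_pot (vert c m n p q r) (Fr n (vv c) - Fr n (vu c)).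
Proof.
rewrite vertE -sum_vdiff -big_enum /=; apply/fshift_pot/foldr_pot => j.
by rewrite -vaP; apply: krow_pot.
Qed.

Lemma homog_vert c m : homog_mf (@wV p q r) n.+1%:Z (vert c m n p q r).
Proof.
rewrite vertE; apply/homog_fshift/homog_foldr => j; apply: homog_krow.
  by have := @whomog_va n p q r r_def p_gt0 c j; congr (whomog _ _ _); rewrite mul2n -addnn PoszD; ring.
by have := @whomog_vb p q r c j; congr (whomog _ _ _); ring.
Qed.

Lemma rename_vdiff b c (al : 'I_p -> 'I_b) (be : 'I_q -> 'I_b) (ga : 'I_r -> 'I_b) :
  rename (cat3 al be ga) (Fr n (@vv p q r c) - Fr n (vu c)) =
  (-1) ^+ c * (rename ga (Fpol n r) - rename al (Fpol n p) - rename be (Fpol n q)).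
Proof.
have hz : rename (cat3 al be ga) (Fr n (@vz p q r)) = rename ga (Fpol n r).
  rewrite [LHS]sub_Fr; apply: eq_sub => j /=.
  by rewrite [LHS](renameX (cat3 al be ga) (rshift (p + q) j)) /cat3 cat2r.
have he : rename (cat3 al be ga) (Fr n (@ve p q r)) = rename al (Fpol n p) + rename be (Fpol n q).
  rewrite Fr_ve // rmorphD; congr (_ + _); rewrite [LHS]sub_sub; apply: eq_sub => j.
    by rewrite [LHS](renameX (cat3 al be ga) (lshift r (lshift q j))) /cat3 !cat2l.
  by rewrite [LHS](renameX (cat3 al be ga) (lshift r (rshift p j))) /cat3 cat2l cat2r.
by case: c; rewrite /vu /vv rmorphB /= hz he; ring.
Qed.

Lemma rename_vz b (al : 'I_p -> 'I_b) (be : 'I_q -> 'I_b) (ga : 'I_r -> 'I_b) j :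
  rename (cat3 al be ga) (vz p q j) = 'X_(ga j).
Proof. by rewrite renameX /cat3 cat2r. Qed.

Lemma genp_rename_ve b c (al : 'I_p -> 'I_b) (be : 'I_q -> 'I_b) (ga : 'I_r -> 'I_b)
    (f : {rmorphism {mpoly rat[b]} -> {mpoly rat[c]}}) :
  genp (fun j => f (rename (cat3 al be ga) (ve p q j))) =
  genp (fun j => f 'X_(al j)) * genp (fun j => f 'X_(be j)).
Proof.
have h := genp_sub_ve r_def (fun i => 'X_(cat3 al be ga i)).
have := congr1 (map_poly f) h; rewrite rmorphM /= !map_genp => {}h.
rewrite [LHS]h; congr (_ * _); apply: eq_genp => j /=.
  by congr (f _); rewrite [LHS](renameX (cat3 al be ga) (lshift r (lshift q j))) /cat3 !cat2l.
by congr (f _); rewrite [LHS](renameX (cat3 al be ga) (lshift r (rshift p j))) /cat3 cat2l cat2r.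
Qed.

End Vertex.

Section ReducedRows.
Variables (n r b : nat) (E Z : 'I_r -> {mpoly rat[b]}) (c : bool).
Definition rU := if c then Z else E.
Definition rV := if c then E else Z.
Definition rB j := rV j - rU j.
Definition rA (j : 'I_r) := quo (psum (mix j rU rV) n - psum (mix j.+1 rU rV) n) (rB j).
(** The common normal form of the two trees: apart from the bit [c], its rows depend on the tree
    only through the classes E and Z of the outer vertex. *)
Definition reduced : fmfact b := foldr (@ftens _) (funit _)
  [seq krow (rA j) (rB j) ((2 * j.+1)%N%:Z - n.+1%:Z) | j <- enum 'I_r].
End ReducedRows.

Section Contract.
Variables (n N k p2 q2 : nat) (w : 'I_N -> nat).
Variables (Y1 : 'I_p2 -> 'I_N) (Y2 : 'I_q2 -> 'I_N).
Hypothesis k_def : k = (p2 + q2)%N.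
Hypothesis p2_gt0 : (0 < p2)%N.
Hypothesis k_le : (k <= n)%N.
Hypothesis wY1 : forall j, w (Y1 j) = wX j.
Hypothesis wY2 : forall j, w (Y2 j) = wX j.

Notation R := {mpoly rat[N]}.
Notation S0 := {mpoly rat[N + 0]}.

(** The external value of the internal edge. The ring of [ve] also contains the thick edge
    variables, which do not occur in it; they are sent to 0. *)
Definition edge (j : 'I_k) : R :=
  sub (cat3 (fun i => 'X_(Y1 i)) (fun i => 'X_(Y2 i)) (fun _ : 'I_k => 0)) (ve p2 q2 j).

Let t : 'I_(p2 + q2 + k) -> 'I_(N + k) :=
  cat3 (lshift k \o Y1) (lshift k \o Y2) (fun j => rshift N j).

Lemma genp_edge b (f : {rmorphism R -> {mpoly rat[b]}}) :
  genp (fun j => f (edge j)) = genp (fun j => f 'X_(Y1 j)) * genp (fun j => f 'X_(Y2 j)).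
Proof.
have := congr1 (map_poly f) (genp_ev_ve k_def (fun i => 'X_(Y1 i)) (fun i => 'X_(Y2 i)) (fun=> 0)).
by rewrite rmorphM /= !map_genp.
Qed.

Lemma rename_edge j : rename t (ve p2 q2 j) = rename (lshift k) (edge j).
Proof.
suff : genp (fun j => rename t (ve p2 q2 j)) = genp (fun j => rename (lshift k) (edge j)).
  by move/genp_inj/(_ j).
rewrite (genp_rename_ve k_def _ _ _ idfun) genp_edge.
by congr (_ * _); apply: eq_genp => i; rewrite /= renameX.
Qed.

Lemma whomog_edge j : whomog w (wX j)%:Z (edge j).
Proof.
apply: (whomog_sub (w := @wV p2 q2 k)); last exact: whomog_ve.
apply: cat2P => i; last by rewrite /cat3 cat2r; apply: whomog0.
rewrite /cat3 /wV cat2l; elim/cat2P: i => i; rewrite /cat3 cat2l ?cat2l ?cat2r.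
  by rewrite -wY1; apply: whomogX.
by rewrite -wY2; apply: whomogX.
Qed.

Lemma rename_vb c j : rename t (vb c j) = lin_row c edge j.
Proof.
rewrite /vb /vu /vv /lin_row -rename_edge -(rename_vz (lshift k \o Y1) (lshift k \o Y2)) -/t.
by case: c; rewrite rmorphB /=; ring.
Qed.

Variables (p q r : nat).
Hypothesis r_def : r = (p + q)%N.
Hypothesis p_gt0 : (0 < p)%N.
Hypothesis r_le : (r <= n)%N.
Variables (s : 'I_(p + q + r) -> 'I_(N + k)).
Hypothesis ws : forall i, cat2 w (@wX k) (s i) = wV i.

Variables E Z : 'I_r -> S0.
Hypothesis hE : forall j, evalX edge (rename s (ve p q j)) = E j.
Hypothesis hZ : forall j, evalX edge (rename s (vz p q j)) = Z j.
Hypothesis EZ : forall j, Z j - E j != 0.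

Variables (c : bool) (m m' : int) (om : R).
Let V := vert c m n p q r.
Let V' := vert c m' n p2 q2 k.
Hypothesis pot : rename s (Fr n (@vv p q r c) - Fr n (vu c))
  + rename t (Fr n (@vv p2 q2 k c) - Fr n (vu c)) = rename (lshift k) om.

Lemma eval_vb j : evalX edge (rename s (vb c j)) = rB E Z c j.
Proof. by rewrite /vb /vv /vu /rB /rV /rU; case: c; rewrite !rmorphB /= hE hZ. Qed.

Lemma eval_Fr i : evalX edge (rename s (Fr n (mix i (@vu p q r c) (vv c)))) =
  psum (mix i (rU E Z c) (rV E Z c)) n.
Proof.
rewrite /evalX sub_rename sub_Fr; apply: eq_sub => j.
rewrite /= -sub_rename -/(evalX edge _) /mix /vu /vv /rU /rV.
by case: c; case: ifP; rewrite ?hE ?hZ.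
Qed.

Lemma rB_neq0 j : rB E Z c j != 0.
Proof. by rewrite /rB /rV /rU; case: c; rewrite // -oppr_eq0 opprB. Qed.

(** Substitution need not commute with a chosen quotient, but it preserves the product with the
    second entry, whose image is nonzero; this determines the first entry. *)
Lemma eval_va j : evalX edge (rename s (va n c j)) = rA n E Z c j.
Proof.
apply/esym/quo_unique; first exact: rB_neq0.
by rewrite -eval_vb -!rmorphM vaP /vdiff !rmorphB /= !eval_Fr.
Qed.

(** The rows of V' are those eliminated, V playing the role of P in [eliminate]; evaluating V at x
    := [edge] gives the reduced rows. *)
Lemma contract : heq
  (restr_mfact (rename (lshift k)) (mfact_of (cat2 w (@wX k)) (boxtimes s t V V')))
  (restr_mfact (rename (lshift 0)) (mfact_of (w0 w) (fshift (m + m') (reduced n E Z c)))).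
Proof.
pose A := fmap (rename s) (foldr (@ftens _) (funit _)
  [seq krow (@va n p q r c j) (vb c j) ((2 * j.+1)%N%:Z - n.+1%:Z) | j <- enum 'I_r]).
have -> : boxtimes s t V V' = ftens (fshift (m + m') A) (foldr (@ftens _) (funit _)
    [seq krow (rename t (va n c j)) (lin_row c edge j) ((wX j)%:Z - n.+1%:Z) | j <- enum 'I_k]).
  rewrite /boxtimes /V /V' !vertE // -ftens_fshift.
  rewrite -[LHS]/(ftens (fshift m A) (fshift m' (fmap (rename t) (foldr _ _ _)))).
  congr (ftens _ (fshift m' _)); rewrite fmap_foldr -map_comp; congr foldr.
  by apply: eq_map => j /=; rewrite fmap_krow /= rename_vb.
apply: heq_trans (heq_foldl _ _ _ _) _.
have hA : homog_mf (cat2 w (@wX k)) n.+1%:Z (fshift (m + m') A).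
  apply/homog_fshift; apply: (homog_fmap (w := @wV p q r)).
    by move=> d f; apply: whomog_rename.
  have := homog_vert r_def p_gt0 r_le c 0; rewrite vertE // => -[h0 h1]; split=> i j.
    by have := h0 i j; rewrite /= !addr0.
  by have := h1 i j; rewrite /= !addr0.
have pA : has_pot (fshift (m + m') A) (rename s (Fr n (@vv p q r c) - Fr n (vu c))).
  apply/fshift_pot/fmap_pot; have := @vert_pot n p q r r_def p_gt0 r_le c 0.
  by rewrite vertE.
have -> : fshift (m + m') (reduced n E Z c) = fmap (evalX edge) (fshift (m + m') A).
  rewrite -[RHS]/(fshift (m + m') (fmap _ A)); congr fshift.
  rewrite /A [in RHS]fmap_foldr -map_comp fmap_foldr -map_comp; congr foldr.
  by apply: eq_map => j /=; rewrite !fmap_krow /= eval_va eval_vb.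
apply: (eliminate (rho := rename s (Fr n (@vv p q r c) - Fr n (vu c))) (om := om)) => //.
- exact: whomog_edge.
- move=> j; apply: (whomog_rename (w := @wV p2 q2 k)); last first.
    have := @whomog_va n p2 q2 k k_def p2_gt0 c j; congr (whomog _ _ _).
    by rewrite mul2n -addnn PoszD.
  apply: cat2P => i; last by rewrite /t /wV /cat3 !cat2r.
  rewrite /t /wV /cat3 cat2l [in RHS]cat2l.
  by elim/cat2P: i => i; rewrite !(cat2l, cat2r).
- rewrite -pot; congr (_ + _); rewrite -sum_vdiff rmorph_sum; apply: eq_bigr => j _.
  by rewrite -rename_vb -rmorphM /= vaP.
Qed.

End Contract.

(** * The two trees and their common contraction *)

Section Trees.
Variables (n i1 i2 i3 i4 i5 i6 : nat).
Hypotheses (i1_gt0 : (0 < i1)%N) (i2_gt0 : (0 < i2)%N).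
Hypotheses (i5_def : i5 = (i1 + i2)%N) (i6_def : i6 = (i2 + i3)%N).
Hypotheses (i4_def : i4 = (i1 + i2 + i3)%N) (i4_le : (i4 <= n)%N).

Let NR := (i1 + i2 + i3 + i4)%N.
Let X1 (j : 'I_i1) : 'I_NR := lshift i4 (lshift i3 (lshift i2 j)).
Let X2 (j : 'I_i2) : 'I_NR := lshift i4 (lshift i3 (rshift i1 j)).
Let X3 (j : 'I_i3) : 'I_NR := lshift i4 (rshift (i1 + i2) j).
Let X4 (j : 'I_i4) : 'I_NR := rshift (i1 + i2 + i3) j.
Let w : 'I_NR -> nat := cat2 (cat3 (@wX i1) (@wX i2) (@wX i3)) (@wX i4).
Let om (c : bool) : {mpoly rat[NR]} := (-1) ^+ c *
  (rename X4 (Fpol n i4) - rename X1 (Fpol n i1) - rename X2 (Fpol n i2) - rename X3 (Fpol n i3)).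

Let wX1 j : w (X1 j) = wX j. Proof. by rewrite /w /X1 /cat3 !cat2l. Qed.
Let wX2 j : w (X2 j) = wX j. Proof. by rewrite /w /X2 /cat3 !cat2l cat2r. Qed.
Let wX3 j : w (X3 j) = wX j. Proof. by rewrite /w /X3 /cat3 cat2l cat2r. Qed.
Let wX4 j : w (X4 j) = wX j. Proof. by rewrite /w /X4 cat2r. Qed.

Let whomog_om c : whomog w (2 * n.+1)%N (om c).
Proof.
rewrite /om -[X in whomog _ X]add0r; apply: whomogM.
  by case: c; [apply/whomogN/whomog1 | apply: whomog1].
by do ![apply: whomogB]; apply: (whomog_rename (w := @wX _)) => //; apply: whomog_Fpol.
Qed.

Let tree5 c m m' : fmfact (NR + i5) :=
  boxtimes (cat3 (fun j => rshift NR j) (lshift i5 \o X3) (lshift i5 \o X4))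
    (cat3 (lshift i5 \o X1) (lshift i5 \o X2) (fun j => rshift NR j))
    (vert c m n i5 i3 i4) (vert c m' n i1 i2 i5).

Let tree6 c m m' : fmfact (NR + i6) :=
  boxtimes (cat3 (lshift i6 \o X1) (fun j => rshift NR j) (lshift i6 \o X4))
    (cat3 (lshift i6 \o X2) (lshift i6 \o X3) (fun j => rshift NR j))
    (vert c m n i1 i6 i4) (vert c m' n i2 i3 i6).

Let base (i : 'I_NR) : {mpoly rat[NR + 0]} := 'X_(lshift 0 i).
(** The total class imposed on the outer thick edge; each tree computes it with its own
    bracketing. *)
Let G := genp (base \o X1) * genp (base \o X2) * genp (base \o X3).
Let E (j : 'I_i4) := G`_j.+1.
Let Z (j : 'I_i4) := base (X4 j).

Let EZ j : Z j - E j != 0.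
Proof.
pose u : 'I_(NR + 0) -> {mpoly rat[0]} := cat2 (cat2 (fun=> 0) (fun=> 1)) (fun=> 0).
pose f : {rmorphism {mpoly rat[NR + 0]} -> {mpoly rat[0]}} := sub u.
have fX i : f (base i) = u (lshift 0 i) by exact: subX.
have f0 k (X : 'I_k -> 'I_NR) : (forall j, exists i, X j = lshift i4 i) ->
    map_poly f (genp (base \o X)) = 1.
  move=> hX; rewrite map_genp /genp big1 ?addr0 // => i _; have [l Xl] := hX i.
  by rewrite /= fX Xl /u !cat2l scale0r.
have fE : f (E j) = 0.
  rewrite /E -coef_map /G !rmorphM /= !f0; try by move=> i; eexists.
  by rewrite !mulr1 coef1.
apply/eqP => /(congr1 f); rewrite rmorphB rmorph0 fE subr0 /Z fX /u cat2l /X4 cat2r.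
by move/eqP; rewrite oner_eq0.
Qed.

Let i5_le : (i5 <= n)%N. Proof. by clear - i5_def i4_def i4_le; lia. Qed.
Let i6_le : (i6 <= n)%N. Proof. by clear - i6_def i4_def i4_le; lia. Qed.
Let i4_5 : i4 = (i5 + i3)%N. Proof. by rewrite i5_def. Qed.
Let i4_6 : i4 = (i1 + i6)%N. Proof. by rewrite i6_def addnA. Qed.
Let i5_gt0 : (0 < i5)%N. Proof. by rewrite i5_def addn_gt0 i1_gt0. Qed.

Let genp_coef (u : 'I_i4 -> {mpoly rat[NR + 0]}) j : genp u = G -> u j = E j.
Proof. by move=> uG; rewrite /E -uG coef_genp. Qed.

Let evalX_base k (e : 'I_k -> {mpoly rat[NR]}) i : evalX e 'X_(lshift k i) = base i.
Proof. by rewrite /evalX subX cat2l. Qed.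

Let evalX_int k (e : 'I_k -> {mpoly rat[NR]}) j : evalX e 'X_(rshift NR j) = rename (lshift 0) (e j).
Proof. by rewrite /evalX subX cat2r. Qed.

Let genp_base k (X : 'I_k -> 'I_NR) :
  genp (fun j => rename (lshift 0) 'X_(X j)) = genp (base \o X).
Proof. by apply: eq_genp => j; rewrite renameX. Qed.

Let pot5 c : rename (cat3 (fun j => rshift NR j) (lshift i5 \o X3) (lshift i5 \o X4))
      (Fr n (@vv i5 i3 i4 c) - Fr n (vu c)) +
    rename (cat3 (lshift i5 \o X1) (lshift i5 \o X2) (fun j => rshift NR j))
      (Fr n (@vv i1 i2 i5 c) - Fr n (vu c)) = rename (lshift i5) (om c).
Proof.
rewrite !rename_vdiff // /om rmorphM rmorphXn rmorphN1 !rmorphB /= !rename_rename.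
by rewrite -mulrDr; congr (_ * _); ring.
Qed.

Let pot6 c : rename (cat3 (lshift i6 \o X1) (fun j => rshift NR j) (lshift i6 \o X4))
      (Fr n (@vv i1 i6 i4 c) - Fr n (vu c)) +
    rename (cat3 (lshift i6 \o X2) (lshift i6 \o X3) (fun j => rshift NR j))
      (Fr n (@vv i2 i3 i6 c) - Fr n (vu c)) = rename (lshift i6) (om c).
Proof.
rewrite !rename_vdiff // /om rmorphM rmorphXn rmorphN1 !rmorphB /= !rename_rename.
by rewrite -mulrDr; congr (_ * _); ring.
Qed.

Let contract5 c m m' : heq
  (restr_mfact (rename (lshift i5)) (mfact_of (cat2 w (@wX i5)) (tree5 c m m')))
  (restr_mfact (rename (lshift 0)) (mfact_of (w0 w) (fshift (m + m') (reduced n E Z c)))).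
Proof.
apply: (contract i5_def i1_gt0 i5_le wX1 wX2 i4_5 i5_gt0 i4_le _ _ _ EZ m m' (pot5 c)).
- apply: cat2P => i; last by rewrite /wV /cat3 !cat2r /= cat2l wX4.
  by rewrite /wV /cat3 !cat2l; elim/cat2P: i => i; rewrite !(cat2l, cat2r).
- move=> j; apply: (@genp_coef (fun j => _) j).
  rewrite (genp_rename_ve i4_5 _ _ _ (evalX _)) /G; congr (_ * _).
    rewrite (eq_genp (v := fun j => rename (lshift 0) (edge X1 X2 j))); last first.
      by move=> i; apply: evalX_int.
    by rewrite (genp_edge _ _ i5_def) !genp_base.
  by apply: eq_genp => i; apply: evalX_base.
- by move=> j; rewrite rename_vz; apply: evalX_base.
Qed.

Let contract6 c m m' : heq
  (restr_mfact (rename (lshift i6)) (mfact_of (cat2 w (@wX i6)) (tree6 c m m')))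
  (restr_mfact (rename (lshift 0)) (mfact_of (w0 w) (fshift (m + m') (reduced n E Z c)))).
Proof.
apply: (contract i6_def i2_gt0 i6_le wX2 wX3 i4_6 i1_gt0 i4_le _ _ _ EZ m m' (pot6 c)).
- apply: cat2P => i; last by rewrite /wV /cat3 !cat2r /= cat2l wX4.
  by rewrite /wV /cat3 !cat2l; elim/cat2P: i => i; rewrite !(cat2l, cat2r).
- move=> j; apply: (@genp_coef (fun j => _) j).
  (* Here the bracketing of the second tree is turned into that of [G]. *)
  rewrite (genp_rename_ve i4_6 _ _ _ (evalX _)) /G -mulrA; congr (_ * _).
    by apply: eq_genp => i; apply: evalX_base.
  rewrite (eq_genp (v := fun j => rename (lshift 0) (edge X2 X3 j))); last first.
    by move=> i; apply: evalX_int.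
  by rewrite (genp_edge _ _ i6_def) !genp_base.
- by move=> j; rewrite rename_vz; apply: evalX_base.
Qed.

Lemma tree_iso c m5 m5' m6 m6' : m5 + m5' = m6 + m6' ->
  hmf_iso w (om c)
    (restr_mfact (rename (lshift i5)) (mfact_of (cat2 w (@wX i5)) (tree5 c m5 m5')))
    (restr_mfact (rename (lshift i6)) (mfact_of (cat2 w (@wX i6)) (tree6 c m6 m6'))).
Proof.
move=> mm; split.
- apply: restr_is_mfact (@whomog_om c); rewrite -pot5.
  by apply: ftens_pot; apply: fmap_pot; apply: vert_pot.
- apply: restr_is_mfact (@whomog_om c); rewrite -pot6.
  by apply: ftens_pot; apply: fmap_pot; apply: vert_pot.
- by apply: heq_trans (contract5 _ _ _) _; rewrite mm; apply/heq_sym/contract6.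
Qed.

End Trees.

Lemma merge_mfE n p q r : merge_mf n p q r = vert false 0 n p q r.
Proof. by rewrite /vert fshift0. Qed.

Theorem proposition3p7 (n i1 i2 i3 i4 i5 i6 : nat)
  (hi1 : (1 <= i1 <= n - 2)%N) (hi2 : (1 <= i2 <= n - 2)%N)
  (hi3 : (1 <= i3 <= n - 2)%N)
  (hi5 : i5 = (i1 + i2)%N) (hi5n : (i5 <= n - 1)%N)
  (hi6 : i6 = (i2 + i3)%N) (hi6n : (i6 <= n - 1)%N)
  (hi4 : i4 = (i1 + i2 + i3)%N) (hi4n : (i4 <= n)%N) :
  let NR := (i1 + i2 + i3 + i4)%N in
  let X1 : 'I_i1 -> 'I_NR := fun j => lshift i4 (lshift i3 (lshift i2 j)) in
  let X2 : 'I_i2 -> 'I_NR := fun j => lshift i4 (lshift i3 (rshift i1 j)) in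
  let X3 : 'I_i3 -> 'I_NR := fun j => lshift i4 (rshift (i1 + i2) j) in
  let X4 : 'I_i4 -> 'I_NR := fun j => rshift (i1 + i2 + i3) j in
  let w : 'I_NR -> nat := cat2 (cat3 (@wX i1) (@wX i2) (@wX i3)) (@wX i4) in
  let omega : {mpoly rat[NR]} :=
    rename X4 (Fpol n i4) - rename X1 (Fpol n i1) - rename X2 (Fpol n i2)
      - rename X3 (Fpol n i3) in
  let w5 : 'I_(NR + i5) -> nat := cat2 w (@wX i5) in
  let w6 : 'I_(NR + i6) -> nat := cat2 w (@wX i6) in
  let in5 : 'I_NR -> 'I_(NR + i5) := lshift i5 in
  let in6 : 'I_NR -> 'I_(NR + i6) := lshift i6 in
  let X5 : 'I_i5 -> 'I_(NR + i5) := fun j => rshift NR j in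
  let X6 : 'I_i6 -> 'I_(NR + i6) := fun j => rshift NR j in
  let s5 := cat3 X5 (in5 \o X3) (in5 \o X4) in
  let t5 := cat3 (in5 \o X1) (in5 \o X2) X5 in
  let s6 := cat3 (in6 \o X1) X6 (in6 \o X4) in
  let t6 := cat3 (in6 \o X2) (in6 \o X3) X6 in
  hmf_iso w omega
    (restr_mfact (rename in5) (mfact_of w5
       (boxtimes s5 t5 (merge_mf n i5 i3 i4) (merge_mf n i1 i2 i5))))
    (restr_mfact (rename in6) (mfact_of w6
       (boxtimes s6 t6 (merge_mf n i1 i6 i4) (merge_mf n i2 i3 i6)))) /\
  hmf_iso w (- omega)
    (restr_mfact (rename in5) (mfact_of w5
       (boxtimes s5 t5 (split_mf n i5 i3 i4) (split_mf n i1 i2 i5))))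
    (restr_mfact (rename in6) (mfact_of w6
       (boxtimes s6 t6 (split_mf n i1 i6 i4) (split_mf n i2 i3 i6)))).
Proof.
move=> NR X1 X2 X3 X4 w omega w5 w6 in5 in6 X5 X6 s5 t5 s6 t6.
have /andP[i1_gt0 _] := hi1; have /andP[i2_gt0 _] := hi2.
have iso := @tree_iso n i1 i2 i3 i4 i5 i6 i1_gt0 i2_gt0 hi5 hi6 hi4 hi4n.
split.
  by have := iso false 0 0 0 0 erefl; rewrite expr0 mul1r !merge_mfE.
(* Both sides equal -(i1 i2 + i1 i3 + i2 i3). *)
have sh : - (i5 * i3)%:Z + - (i1 * i2)%:Z = - (i1 * i6)%:Z + - (i2 * i3)%:Z.
  by rewrite hi5 hi6 !PoszM !PoszD; ring.
by have := iso true _ _ _ _ sh; rewrite expr1 mulN1r.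
Qed.
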